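(* Consider the closed-loop system described in the context, with arbitrary positive $\xi,\eta,\lambda_d,T$. For some positive $\kappa_1,\kappa_2,\kappa_3,\kappa_4$ (the coefficients in the dynamics of the triggering variable $m$), there exists a minimal dwell-time $\underline\tau>0$ such that $t_{i+1}-t_i\ge\underline\tau$ for all $i\in\{0,1,2,\dots\}$.
   Context: **Plant.** Scalar ODE state $\zeta(t)$, PDE state $u(x,t)$, $x\in[0,1]$, $t\ge 0$, $u[t]:=u(\cdot,t)$, $\|\cdot\|$ the $L^2(0,1)$ norm: $$\dot\zeta(t)=a\zeta(t)+b\,u(0,t),\quad u_t=\varepsilon u_{xx}+\lambda u,\quad u_x(0,t)=0,\quad u_x(1,t)+q\,u(1,t)=U_d(t).$$ $\varepsilon>0$, $b\ne 0$, $q$ are known; $\theta=[\lambda,a]^T$ is unknown with $\underline\lambda\le\lambda\le\overline\lambda$, $\underline a\le a\le\overline a$, where the bounds are known positive constants. $\Theta=\{\ell\in\mathbb R^2:\underline\lambda\le\ell_1\le\overline\lambda,\ \underline a\le\ell_2\le\overline a\}$. Assume $q>\frac14+\frac{\overline\lambda}{2\varepsilon}$. The ODE is understood in the integrated sense; solutions satisfy $u\in C^0([t_i,t_{i+1}];L^2(0,1))\cap C^1((t_i,t_{i+1})\times[0,1])$ with $u[t]\in C^2([0,1])$ on each inter-event interval, with initial data $u[0]\in L^2(0,1)$, $\zeta(0)\in\mathbb R$, $m(0)<0$, $\hat\theta(0)\in\Theta$. **Gains.** Fix $\kappa$ with $b\kappa>\overline a$. For $\theta=[\lambda,a]^T\in\Theta$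 let $a_{\rm m}=b\kappa-a$, $r=q-\frac{\lambda}{2\varepsilon}$, $\gamma(x)=-\kappa\cos\big(\sqrt{a_{\rm m}/\varepsilon}\,x\big)$, $\Psi(x,y)=-\frac{\lambda}{\varepsilon}x\,\frac{I_1(s)}{s}$ with $s=\sqrt{\lambda(x^2-y^2)/\varepsilon}$ ($I_1$ the modified Bessel function of the first kind; $I_1(s)/s:=1/2$ at $s=0$), and let $h(x,y)$, $0\le y\le x\le1$, be the solution of $$\varepsilon h_y(x,0)+b\gamma(x)-b\int_0^xh(x,y)\gamma(y)dy=0,\quad h_{yy}=h_{xx},\quad h_y(x,x)+h_x(x,x)=0,\quad h(0,0)=0.$$ Define $$K_1(1,y;\theta)=\Psi_x(1,y)+h_x(1,y)+rh(1,y)+r\Psi(1,y)-\int_y^1(h_x(1,z)+rh(1,z))\Psi(z,y)dz,$$ $$K_2(1;\theta)=\gamma'(1)+r\gamma(1)-\int_0^1(h_x(1,y)+rh(1,y))\gamma(y)dy.$$ $K_1(1,y;\vartheta)$, $K_2(1;\vartheta)$ for $\vartheta\in\Theta$ denote the same expressions with $\theta$ replaced by $\vartheta$ everywhere. **Controller.** For $t\in[t_i,t_{i+1})$, $U_d(t)=\int_0^1K_1(1,y;\hat\theta(t_i))u(y,t_i)dy+K_2(1;\hat\theta(t_i))\zeta(t_i)$, and $$d(t)=\int_0^1K_1(1,y;\hat\theta(t_i))(u(y,t)-u(y,t_i))dy+K_2(1;\hat\theta(t_i))(\zeta(t)-\zeta(t_i)).$$ **Event-triggering mechanism.** $t_0=0$,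 $t_{i+1}=\min\{\inf\{t>t_i:d(t)^2\ge-\xi m(t)\},\,t_i+T\}$ for $i=0,1,2,\dots$, where $m$ is continuous, $m(0)<0$, and on each $(t_i,t_{i+1})$ $$\dot m=-\eta m+\lambda_dd^2-\kappa_1u(1,t)^2-\kappa_2u(0,t)^2-\kappa_3\|u[t]\|^2-\kappa_4\zeta(t)^2.$$ **Identifier.** Fix an integer $\tilde N\ge1$; $\mu_{i+1}=\min\{t_k:k\in\{0,\dots,i\},\ t_k\ge t_{i+1}-\tilde NT\}$. For $n\in\mathbb N=\{1,2,\dots\}$ let $$\begin{aligned}f_n(t,\mu)=&\int_0^1\sin(\pi nx)u(x,t)dx-\tfrac{\varepsilon\pi n}{b}\zeta(t)-\int_0^1\sin(\pi nx)u(x,\mu)dx+\tfrac{\varepsilon\pi n}{b}\zeta(\mu)\\&+\int_\mu^t\Big[\varepsilon\pi n(-1)^nu(1,\tau)+\varepsilon\pi^2n^2\int_0^1\sin(\pi nx)u(x,\tau)dx\Big]d\tau,\end{aligned}$$ $g_{n,1}(t,\mu)=\int_\mu^t\int_0^1\sin(\pi nx)u(x,\tau)dxd\tau$, $g_{n,2}(t,\mu)=-\frac{\varepsilon\pi n}{b}\int_\mu^t\zeta(\tau)d\tau$. With $\mu=\mu_{i+1}$ and integrals over $[\mu_{i+1},t_{i+1}]$ in $t$: $H_{n,k}=\int g_{n,k}f_n\,dt$ ($k=1,2$), $Q_{n,1}=\int g_{n,1}^2dt$, $Q_{n,2}=\int g_{n,1}g_{n,2}dt$, $Q_{n,3}=\int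 g_{n,2}^2dt$, $Z_n=[H_{n,1},H_{n,2}]^T$, $G_n=\begin{bmatrix}Q_{n,1}&Q_{n,2}\\Q_{n,2}&Q_{n,3}\end{bmatrix}$. The update is $$\hat\theta(t_{i+1})=\operatorname{argmin}\{|\ell-\hat\theta(t_i)|^2:\ \ell\in\Theta,\ Z_n=G_n\ell\ \text{ for all }n\in\mathbb N\}$$ (in particular $\hat\theta(t_i)\in\Theta$ for all $i$). *)

(* Defs.v *)
From HB Require Import structures.
From mathcomp Require Import all_boot all_order all_algebra.
From mathcomp Require Import all_classical all_reals all_analysis.

Set Implicit Arguments.
Unset Strict Implicit.
Unset Printing Implicit Defensive.

Import Order.TTheory GRing.Theory Num.Theory.
Import numFieldNormedType.Exports.

Local Open Scope classical_set_scope.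
Local Open Scope ring_scope.

Section calculus.
Context {R : realType}.
Local Notation mu := (@lebesgue_measure R).

(** [f] is of class C^1 on [D], where [D] is contained in the closure of its
    interior, with partial derivatives [f1], [f2]. At points of [D] that are not
    interior, [f1] and [f2] are the continuous extensions of the derivatives
    (one-sided derivatives where these make sense). *)
Definition C1_on (D : set (R * R)) (f f1 f2 : R -> R -> R) : Prop :=
  [/\ {within D, continuous (fun p : R * R => f p.1 p.2)},
      {within D, continuous (fun p : R * R => f1 p.1 p.2)},
      {within D, continuous (fun p : R * R => f2 p.1 p.2)}
    & forall x y : R, interior D (x, y) ->
        is_derive x 1 (fun x' => f x' y) (f1 x y) /\
        is_derive y 1 (fun y' => f x y') (f2 x y)].

Definition C1_01 (f f' : R -> R) : Prop :=
  [/\ {within `[(0:R), 1], continuous f},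
      {within `[(0:R), 1], continuous f'}
    & forall x : R, 0 < x < 1 -> is_derive x 1 f (f' x)].

Definition L2_01 (f : R -> R) : Prop :=
  measurable_fun `[(0:R), 1] f /\
  mu.-integrable `[(0:R), 1] (fun x => (f x ^+ 2)%:E).

Definition L2norm_sq (f : R -> R) : R := \int[mu]_(x in `[(0:R), 1]) (f x ^+ 2).

(** [u] is in C^0([s,e]; L^2(0,1)), with [u x t] the value at position [x] and
    time [t]. *)
Definition C0_L2 (s e : R) (u : R -> R -> R) : Prop :=
  forall t : R, s <= t <= e ->
    L2_01 (u ^~ t) /\
    (fun t' => L2norm_sq (fun x => u x t' - u x t))
      @ within `[s, e] (nbhs t) --> (0 : R).

(** Modified Bessel function of the first kind of order one, and I_1(s)/s
    extended by its value 1/2 at 0. *)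
Definition besselI1 (s : R) : R :=
  limn (series (fun k : nat => (s / 2) ^+ (2 * k + 1) / (k`! * (k.+1)`!)%:R)).

Definition besselI1_div (s : R) : R :=
  if s == 0 then 1 / 2 else besselI1 s / s.

End calculus.

(** A parameter vector theta = [lambda, a]^T is a pair. *)
Definition Theta {R : realType} (lamlo lamhi alo ahi : R) : set (R * R) :=
  [set l | lamlo <= l.1 <= lamhi /\ alo <= l.2 <= ahi].

Definition triangle {R : realType} : set (R * R) :=
  [set p | [/\ 0 <= p.2, p.2 <= p.1 & p.1 <= 1]].

Section gains.
Context {R : realType} (eps b q kappa : R).
Local Notation mu := (@lebesgue_measure R).

Definition rgain (th : R * R) : R := q - th.1 / (2 * eps).

Definition gamma (th : R * R) (x : R) : R :=
  - kappa * cos (Num.sqrt ((b * kappa - th.2) / eps) * x).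

Definition Psi (th : R * R) (x y : R) : R :=
  - (th.1 / eps) * x *
    besselI1_div (Num.sqrt (th.1 * (x ^+ 2 - y ^+ 2) / eps)).

(** [h] is a (classical, i.e. C^2) solution of the kernel equations on the
    closed triangle 0 <= y <= x <= 1, and [hx] is its derivative in [x]. *)
Definition kernel_solution (th : R * R) (h hx : R -> R -> R) : Prop :=
  exists hy hxx hxy hyx hyy : R -> R -> R,
    [/\ C1_on triangle h hx hy,
        C1_on triangle hx hxx hxy,
        C1_on triangle hy hyx hyy
      & [/\ forall x : R, 0 <= x <= 1 ->
              eps * hy x 0 + b * gamma th x
                - b * (\int[mu]_(y in `[(0:R), x]) (h x y * gamma th y)) = 0,
            forall x y, triangle (x, y) -> hyy x y = hxx x y,
            forall x : R, 0 <= x <= 1 -> hy x x + hx x x = 0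
          & h 0 0 = 0]].

(** Psi_x(1,y). The derivative is genuine for 0 <= y < 1; the formula for [Psi]
    is not meaningful for x < y, so the value at the single point y = 1 is
    irrelevant ([K1] only occurs under an integral over [0,1]). *)
Definition Psix1 (th : R * R) (y : R) : R := derive1 (fun x => Psi th x y) 1.

(** [h] and [hx] give, for each parameter vector, the kernel and its
    x-derivative. *)
Variables h hx : R * R -> R -> R -> R.

Definition K1 (th : R * R) (y : R) : R :=
  Psix1 th y + hx th 1 y + rgain th * h th 1 y + rgain th * Psi th 1 y
  - \int[mu]_(z in `[y, (1:R)]) ((hx th 1 z + rgain th * h th 1 z) * Psi th z y).

Definition K2 (th : R * R) : R :=
  derive1 (gamma th) 1 + rgain th * gamma th 1
  - \int[mu]_(y in `[(0:R), 1]) ((hx th 1 y + rgain th * h th 1 y) * gamma th y).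

(** Control value for the estimate [th] and the sampled state [(v, z)]. *)
Definition control (th : R * R) (v : R -> R) (z : R) : R :=
  \int[mu]_(y in `[(0:R), 1]) (K1 th y * v y) + K2 th * z.

(** Deviation d(t) for the estimate [th] and the sampling time [s]. *)
Definition deviation (th : R * R) (s : R) (u : R -> R -> R) (zeta : R -> R)
    (t : R) : R :=
  \int[mu]_(y in `[(0:R), 1]) (K1 th y * (u y t - u y s))
  + K2 th * (zeta t - zeta s).

End gains.

Section dynamics.
Context {R : realType} (eps b q : R).
Local Notation mu := (@lebesgue_measure R).

(** [(u, zeta)] solves the plant with true parameters [th] on [[s, e]] under
    the constant input [Ud]. *)
Definition plant_solution (th : R * R) (Ud s e : R)
    (u : R -> R -> R) (zeta : R -> R) : Prop :=
  exists ux ut uxx : R -> R -> R,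
    [/\ C0_L2 s e u,
        C1_on [set p | 0 <= p.1 <= 1 /\ s < p.2 < e] u ux ut,
        forall t, s < t < e -> C1_01 (ux ^~ t) (uxx ^~ t),
        forall t : R, s < t < e ->
          [/\ forall x : R, 0 <= x <= 1 ->
                ut x t = eps * uxx x t + th.1 * u x t,
              ux 0 t = 0
            & ux 1 t + q * u 1 t = Ud]
      & mu.-integrable `[s, e] (fun t => (th.2 * zeta t + b * u 0 t)%:E) /\
        forall t : R, s <= t <= e ->
          zeta t = zeta s
            + \int[mu]_(tau in `[s, t]) (th.2 * zeta tau + b * u 0 tau)].

Definition trigger_solution (eta lamd k1 k2 k3 k4 s e : R)
    (d : R -> R) (u : R -> R -> R) (zeta m : R -> R) : Prop :=
  {within `[s, e], continuous m} /\
  forall t : R, s < t < e ->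
    is_derive t 1 m
      (- eta * m t + lamd * d t ^+ 2 - k1 * u 1 t ^+ 2 - k2 * u 0 t ^+ 2
       - k3 * L2norm_sq (u ^~ t) - k4 * zeta t ^+ 2).

End dynamics.

Section identifier.
Context {R : realType} (eps b : R) (u : R -> R -> R) (zeta : R -> R).
Local Notation mu := (@lebesgue_measure R).

Definition sin_mode (n : nat) (t : R) : R :=
  \int[mu]_(x in `[(0:R), 1]) (sin (pi * n%:R * x) * u x t).

(** In [f_], [g1], [g2], [s] is the left end of the data window. *)
Definition f_ (n : nat) (t s : R) : R :=
  sin_mode n t - eps * pi * n%:R / b * zeta t
  - sin_mode n s + eps * pi * n%:R / b * zeta s
  + \int[mu]_(tau in `[s, t])
      (eps * pi * n%:R * (-1) ^+ n * u 1 tau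
       + eps * pi ^+ 2 * n%:R ^+ 2 * sin_mode n tau).

Definition g1 (n : nat) (t s : R) : R :=
  \int[mu]_(tau in `[s, t]) sin_mode n tau.

Definition g2 (n : nat) (t s : R) : R :=
  - (eps * pi * n%:R / b) * \int[mu]_(tau in `[s, t]) zeta tau.

(** Z_n and G_n for the data window [[s, e]]. *)
Definition Zvec (n : nat) (s e : R) : 'cV[R]_2 :=
  \col_(k < 2) \int[mu]_(t in `[s, e])
    ((if k == 0 then g1 n t s else g2 n t s) * f_ n t s).

Definition Gmat (n : nat) (s e : R) : 'M[R]_2 :=
  \matrix_(k < 2, l < 2) \int[mu]_(t in `[s, e])
    ((if k == 0 then g1 n t s else g2 n t s) *
     (if l == 0 then g1 n t s else g2 n t s)).

Definition col_of_pair (l : R * R) : 'cV[R]_2 :=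
  \col_(k < 2) (if k == 0 then l.1 else l.2).

Definition consistent (s e : R) (l : R * R) : Prop :=
  forall n : nat, (0 < n)%N -> Zvec n s e = Gmat n s e *m col_of_pair l.

End identifier.

(** [x] minimizes |l - c|^2 over l in [A]. *)
Definition is_argmin_dist {R : realType} (A : set (R * R)) (c x : R * R) : Prop :=
  let dist2 (l : R * R) := (l.1 - c.1) ^+ 2 + (l.2 - c.2) ^+ 2 in
  A x /\ forall l, A l -> dist2 x <= dist2 l.

(** mu_{i+1}; since t_{i+1} <= t_i + T and N >= 1, the default value t_i belongs
    to the set whose minimum is taken. *)
Definition window_start {R : realType} (T : R) (N : nat) (t : nat -> R)
    (i : nat) : R :=
  \big[Num.min/t i]_(k < i.+1 | t i.+1 - N%:R * T <= t k) t k.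

(** Closed-loop trajectory: event times [t], estimates [thh i] (held after
    [t i]), states [u], [zeta], [m], for the true parameters [th].

    In [cl_step], [(v, z, w)] is the evolution of (u, zeta, m) from time [t i]
    with input and estimate frozen at their values at [t i], on some
    nondegenerate interval [[t i, e]] containing [t i.+1]; the trajectory
    follows it up to [t i.+1]. For e = t i.+1 this is the solution on the
    inter-event interval itself. Allowing a larger [e] gives the event rule a
    meaning without presupposing [t i < t i.+1]. The infimum is in the extended
    reals, so it is +oo when the condition is never met. *)
Record closed_loop {R : realType} (eps b q lamlo lamhi alo ahi kappa : R)
    (h hx : R * R -> R -> R -> R)
    (xi eta lamd T : R) (N : nat) (k1 k2 k3 k4 : R) (th : R * R)
    (t : nat -> R) (thh : nat -> R * R)
    (u : R -> R -> R) (zeta m : R -> R) : Prop := ClosedLoop {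
  cl_t0 : t 0%N = 0;
  cl_m0 : m 0 < 0;
  cl_thh0 : Theta lamlo lamhi alo ahi (thh 0%N);
  cl_step : forall i : nat,
    exists (e : R) (v : R -> R -> R) (z w : R -> R),
      let d := deviation eps b q kappa h hx (thh i) (t i) v z in
      let Ud :=
        control eps b q kappa h hx (thh i) (u ^~ (t i)) (zeta (t i)) in
      [/\ t i < e /\ t i.+1 <= e,
          forall s, t i <= s <= t i.+1 ->
            [/\ forall x : R, 0 <= x <= 1 -> u x s = v x s,
                zeta s = z s & m s = w s],
          plant_solution eps b q th Ud (t i) e v z,
          trigger_solution eta lamd k1 k2 k3 k4 (t i) e d v z w
        & (t i.+1)%:E =
          Order.min
            (ereal_inf [set s%:E | s in
               [set s | t i < s <= e /\ - xi * w s <= d s ^+ 2]])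
            (t i + T)%:E];
  cl_update : forall i : nat,
    is_argmin_dist
      (Theta lamlo lamhi alo ahi `&`
       consistent eps b u zeta (window_start T N t i) (t i.+1))
      (thh i) (thh i.+1)
}.

(* Main.v *)
Require Import Defs.
From mathcomp Require Import all_boot all_order all_algebra.
From mathcomp Require Import all_classical all_reals all_analysis.
From mathcomp Require Import measurable_realfun ring lra.
Import Order.TTheory GRing.Theory Num.Theory.
Import numFieldNormedType.Exports.
Local Open Scope classical_set_scope.
Local Open Scope ring_scope.

(** The coefficients kappa_i can all be taken equal to 1.

    The kernel equations force h(x,y) = F(x-y), since h_x + h_y is constant
    along the characteristics x + y = const and vanishes on the diagonal. The
    boundary condition at y = 0 is then a Volterra equation for F, equivalent to
    F'' = (a/eps) F, F(0) = 0, F'(0) = - b kappa / eps, so that F is an explicit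
    hyperbolic sine. Together with the power series of I_1(sqrt w)/sqrt w this
    makes K_1(1,.) smooth on [0,1], with bounds uniform over Theta. Two
    integrations by parts then remove all derivatives of u from d', and
    d'^2 <= C (d^2 + U) with U = u(1,t)^2 + u(0,t)^2 + |u[t]|^2 + zeta^2 and C
    depending only on the data.

    Since m' = - eta m + lambda_d d^2 - U, the term C U in d'^2 is absorbed by
    m: for a ramp sigma growing linearly from xi/2 to xi over a suitable time,
    g = d^2 + sigma m satisfies g' <= beta g as long as m < 0. Hence
    d^2 < - sigma m <= - xi m during that time, which in turn keeps m negative. *)

(** One dwell-time has to serve every trajectory and every estimate, so all bounds must be uniform
    over [Theta]. The hypothesis on [h] supplies a C^2 kernel for each parameter separately, with no
    control between parameters; solving for it in closed form reduces uniformity to bounds on lambda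
    and a, where a stays away from 0 because of the division by sqrt(a/eps).

    The input held between events depends on the state at the last event, which U at the current
    time does not control. But it equals the integral of K_1 u plus K_2 zeta minus d at the current
    time, so it is bounded by a multiple of sqrt(d^2 + U); hence the d^2 in the bound on d'^2.

    The solution is differentiable only inside an inter-event interval. At the ends u is continuous
    in L^2 alone, so d is continuous there through its integral against K_1, and the derivative
    estimates live in the interior.

    The ramp starts above 0 because sigma multiplies the -U that absorbs C U. It grows because
    sigma' m, negative as long as m < 0, has to cancel the positive terms in -m that arise in the
    growth of d^2 + sigma m. *)

Ltac auto_is_derive :=
  eapply is_derive_eq; [typeclasses eauto | rewrite /GRing.scale /=].

(** * One-variable calculus and the chain rule along a line *)

Lemma is_derive_of_cvg (R : realType) (f : R -> R) (x d : R) :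
  (fun h => h^-1 * (f (x + h) - f x)) @ 0^' --> d -> is_derive x 1 f d.
Proof.
move=> fd.
have H : (fun h => h^-1 *: ((f \o shift x) (h *: 1) - f x)) @ 0^' --> d.
  rewrite (_ : (fun h => _) = fun h => h^-1 * (f (x + h) - f x)) //.
  by apply/funext => h; rewrite /= scaler1 (addrC h).
by apply: DeriveDef; [apply/cvg_ex; exists d | apply/cvg_lim].
Qed.

Lemma cvg_of_is_derive (R : realType) (f : R -> R) (x d : R) :
  is_derive x 1 f d -> (fun h => h^-1 * (f (x + h) - f x)) @ 0^' --> d.
Proof.
move=> [df <-]; have := df; rewrite /derivable /derive.
set q := (q in q @ _). set q' := (q in _ -> q @ _ --> _).
have -> : q' = q by apply/funext => h; rewrite /q /q' /= scaler1 (addrC h).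
by [].
Qed.

Lemma is_derive_derivable (R : realType) (f : R -> R) (x d : R) :
  is_derive x 1 f d -> derivable f x 1.
Proof. by case. Qed.

Lemma is_derive_continuous (R : realType) (f : R -> R) (x d : R) :
  is_derive x 1 f d -> {for x, continuous f}.
Proof. by move=> [df _]; apply/differentiable_continuous/derivable1_diffP. Qed.

Lemma continuous_FTC2_is_derive (R : realType) (f F : R -> R) (a b : R) :
  a < b -> {within `[a, b], continuous f} -> {within `[a, b], continuous F} ->
  (forall x, a < x < b -> is_derive x 1 F (f x)) ->
  \int[@lebesgue_measure R]_(x in `[a, b]) f x = F b - F a.
Proof.
move=> ab cf cF dF; rewrite /Rintegral (@continuous_FTC2 R f F a b) //.
- have /(continuous_within_itvP _ ab)[_ Fa Fb] := cF.
  split => // x; rewrite in_itv /= => /dF H; exact: ex_derive.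
- by move=> x; rewrite in_itv /= => /dF H; rewrite derive1E derive_val.
Qed.

Lemma is_derive_integral (R : realType) (f : R -> R) (a x u : R) :
  a < x < u -> (@lebesgue_measure R).-integrable `[a, u] (EFin \o f) ->
  {for x, continuous f} ->
  is_derive x 1 (fun y => \int[@lebesgue_measure R]_(t in `[a, y]) f t) (f x).
Proof.
move=> /andP[ax xu] fi fx.
have [dF <-] := continuous_FTC1_closed xu fi ax fx.
by rewrite derive1E; exact: DeriveDef.
Qed.

Lemma is_derive_0_cst (R : realType) (f : R -> R) (a b : R) :
  {within `[a, b], continuous f} ->
  (forall x, a < x < b -> is_derive x 1 f 0) ->
  forall x, a <= x <= b -> f x = f a.
Proof.
move=> cf df x /andP[ax xb].
have [y||c _] := @MVT_segment R f (cst 0) a x ax.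
- rewrite in_itv /= => /andP[ay yx]; apply: df.
  by rewrite ay (lt_le_trans yx).
- by apply: continuous_subspaceW cf; apply: subset_itvl; rewrite bnd_simp.
- by rewrite mul0r => /eqP; rewrite subr_eq0 => /eqP.
Qed.

(** The increment splits into an x-step at the shifted ordinate, handled by the mean value theorem
    and the continuity of [fx], and a y-step, handled by the derivative at the point itself. Nothing
    is asked of the y-partial elsewhere, which spares a continuity proof in the Leibniz rule. *)
Lemma is_derive_line (R : realType) (f fx : R -> R -> R) (fy al be x0 y0 s : R) :
  nbhs ((x0 + al * s, y0 + be * s) : R * R)
    (fun p : R * R => is_derive p.1 1 (f ^~ p.2) (fx p.1 p.2)) ->
  {for (x0 + al * s, y0 + be * s),
     continuous (fun p : R * R => fx p.1 p.2)} ->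
  is_derive (y0 + be * s) 1 (f (x0 + al * s)) fy ->
  is_derive s 1 (fun s => f (x0 + al * s) (y0 + be * s))
    (al * fx (x0 + al * s) (y0 + be * s) + be * fy).
Proof.
set X := x0 + al * s; set Y := y0 + be * s => dfx cfx dfy.
apply: is_derive_of_cvg.
have E h : h^-1 * (f (x0 + al * (s + h)) (y0 + be * (s + h)) - f X Y)
  = h^-1 * (f (X + al * h) (Y + be * h) - f X (Y + be * h))
    + h^-1 * (f X (Y + be * h) - f X Y).
  rewrite !(mulrDr _ s h) !addrA -/X -/Y; ring.
under eq_fun => h do rewrite E.
apply: cvgD; last first.
  have H : is_derive s 1 (fun s => y0 + be * s) be.
    by auto_is_derive; ring.
  have := @is_derive1_comp R (f X) (fun s => y0 + be * s) s fy be.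
  rewrite -/Y => /(_ dfy H) /cvg_of_is_derive; rewrite mulrC.
  apply: cvg_trans; apply: near_eq_cvg; near=> h => /=.
  by rewrite (mulrDr be s h) addrA -/Y.
apply/cvgrPdist_le => e e0.
have e1 : 0 < e / (1 + `|al|) by rewrite divr_gt0 // ltr_pwDl.
have /cvgrPdist_lt /(_ _ e1) cfx' := cfx.
have /nbhs_ballP[r /= r0 Hr] : nbhs ((X, Y) : R * R) (fun p : R * R =>
   is_derive p.1 1 (f ^~ p.2) (fx p.1 p.2) /\
   `|fx X Y - fx p.1 p.2| < e / (1 + `|al|)).
  by apply: filterI; [exact: dfx | exact: cfx'].
have r1 : 0 < r / (1 + `|al| + `|be|) by rewrite divr_gt0 // addr_gt0 ?ltr_pwDl.
near=> h.
have h0 : h != 0 by near: h; exact: nbhs_dnbhs_neq.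
have hr : `|h| < r / (1 + `|al| + `|be|).
  by near: h; apply: dnbhs0_lt.
have hr' : `|h| * (1 + `|al| + `|be|) < r.
  by rewrite -ltr_pdivlMr // addr_gt0 ?ltr_pwDl.
have ah : `|al * h| < r.
  rewrite normrM; have := normr_ge0 h; have := normr_ge0 be; have := normr_ge0 al.
  nra.
have bh : `|be * h| < r.
  rewrite normrM; have := normr_ge0 h; have := normr_ge0 be; have := normr_ge0 al.
  nra.
have B z : `|z - X| <= `|al * h| -> ball ((X, Y) : R * R) r (z, Y + be * h).
  move=> zX; split => /=; rewrite /ball /=.
    by rewrite distrC (le_lt_trans zX).
  by rewrite opprD addrA subrr sub0r normrN.
have [c cX cE] : exists2 c, `|c - X| <= `|al * h| &
    f (X + al * h) (Y + be * h) - f X (Y + be * h)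
    = fx c (Y + be * h) * (al * h).
  have [H|H] := leP 0 (al * h).
    have [|||c] := @MVT_segment R (f ^~ (Y + be * h)) (fx ^~ (Y + be * h)) X (X + al * h).
    - by rewrite lerDl.
    - move=> z; rewrite in_itv /= => /andP[z1 z2].
      have /Hr[] // : ball ((X, Y) : R * R) r (z, Y + be * h).
      by apply: B; rewrite (ger0_norm H) ger0_norm; lra.
    - apply: derivable_within_continuous => z; rewrite in_itv /= => /andP[z1 z2].
      have /Hr[[]] // : ball ((X, Y) : R * R) r (z, Y + be * h).
      by apply: B; rewrite (ger0_norm H) ger0_norm; lra.
    - rewrite in_itv /= => /andP[z1 z2] cE; exists c.
        by rewrite (ger0_norm H) ger0_norm; lra.
      by rewrite cE; ring.
  have [|||c] := @MVT_segment R (f ^~ (Y + be * h)) (fx ^~ (Y + be * h)) (X + al * h) X.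
  - by rewrite gerDl ltW.
  - move=> z; rewrite in_itv /= => /andP[z1 z2].
    have /Hr[] // : ball ((X, Y) : R * R) r (z, Y + be * h).
    by apply: B; rewrite (ltr0_norm H) ler0_norm; lra.
  - apply: derivable_within_continuous => z; rewrite in_itv /= => /andP[z1 z2].
    have /Hr[[]] // : ball ((X, Y) : R * R) r (z, Y + be * h).
    by apply: B; rewrite (ltr0_norm H) ler0_norm; lra.
  - rewrite in_itv /= => /andP[z1 z2] cE; exists c.
      by rewrite (ltr0_norm H) ler0_norm; lra.
    by rewrite -opprB cE; ring.
have /Hr[_ /= Hc] := B _ cX.
rewrite cE (_ : h^-1 * _ = al * fx c (Y + be * h)); last by field.
rewrite -mulrBr normrM.
apply: (@le_trans _ _ (`|al| * (e / (1 + `|al|)))).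
  by apply: ler_wpM2l => //; exact: ltW.
rewrite mulrA ler_pdivrMr ?ltr_pwDl //.
by rewrite mulrC ler_pM2l // lerDr.
Unshelve. all: by end_near. Qed.

Lemma is_derive_onem (R : realType) (f : R -> R) (z d : R) :
  is_derive (1 - z) 1 f d -> is_derive z 1 (fun y => f (1 - y)) (- d).
Proof.
move=> df; have D : is_derive z 1 (fun y => 1 - y) (-1) by auto_is_derive; ring.
by have := @is_derive1_comp R f (fun y => 1 - y) z _ _ df D; rewrite mulrN1.
Qed.

(** * Integrals depending on a parameter *)

Lemma within_continuous_cvg (T U : topologicalType) (A : set T) (f : T -> U)
    (S : Type) (F : set_system S) (g : S -> T) (x : T) :
  Filter F -> {within A, continuous f} -> A x -> g @ F --> x ->
  (\forall s \near F, A (g s)) -> (f \o g) @ F --> f x.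
Proof.
move=> FF /subspace_continuousP cf Ax gx gA.
apply: cvg_trans (cf _ Ax) => W /= HW.
rewrite /fmap /nbhs /=; rewrite /fmap /nbhs /= in HW.
have := gx _ HW; rewrite /fmap /nbhs /= => HW'.
by apply: (@filterS2 S F FF _ _ _ _ gA HW') => s Ags; exact.
Qed.

Lemma within_continuous_slice1 (R : realType) (D : set (R * R))
    (f : R -> R -> R) (A : set R) (t : R) :
  {within D, continuous (fun p : R * R => f p.1 p.2)} ->
  (forall x, A x -> D (x, t)) -> {within A, continuous (f ^~ t)}.
Proof.
move=> cf AD; apply/subspace_continuousP => x Ax.
apply: (@within_continuous_cvg (R * R)%type R D (fun p => f p.1 p.2) R _
  (fun y => (y, t)) (x, t) _ cf (AD _ Ax)).
- by apply: (@cvg_pair _ _ _ _ (nbhs x) (nbhs t)); [exact: cvg_within | exact: cvg_cst].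
- near=> y; apply: AD; near: y; exact: withinT.
Unshelve. all: by end_near. Qed.

Lemma within_continuous_slice2 (R : realType) (D : set (R * R))
    (f : R -> R -> R) (A : set R) (x : R) :
  {within D, continuous (fun p : R * R => f p.1 p.2)} ->
  (forall t, A t -> D (x, t)) -> {within A, continuous (f x)}.
Proof.
move=> cf AD; apply/subspace_continuousP => t At.
apply: (@within_continuous_cvg (R * R)%type R D (fun p => f p.1 p.2) R _
  (fun s => (x, s)) (x, t) _ cf (AD _ At)).
- by apply: (@cvg_pair _ _ _ _ (nbhs x) (nbhs t)); [exact: cvg_cst | exact: cvg_within].
- near=> y; apply: AD; near: y; exact: withinT.
Unshelve. all: by end_near. Qed.

Lemma continuous_rectangle_bounded (R : realType) (f : R -> R -> R)
    (a b c d : R) :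
  {within [set p : R * R | a <= p.1 <= b /\ c <= p.2 <= d],
     continuous (fun p : R * R => f p.1 p.2)} ->
  exists2 M : R, 0 < M &
    forall x t, a <= x <= b -> c <= t <= d -> `|f x t| <= M.
Proof.
move=> cf.
have cpt : compact [set p : R * R | a <= p.1 <= b /\ c <= p.2 <= d].
  rewrite (_ : [set _ | _] = (`[a, b]%classic : set R) `*` `[c, d]%classic).
    by apply: compact_setX; exact: segment_compact.
  by apply/seteqP; split => -[x t] /=; rewrite !in_itv.
have /compact_bounded[M [Mr HM]] := continuous_compact cf cpt.
exists (Num.max M 0 + 1); first by rewrite ltr_pwDr // le_max lexx orbT.
move=> x t xab tcd; apply: (HM (Num.max M 0 + 1)).
  by rewrite ltr_pwDr // le_max lexx.
by exists (x, t).
Qed.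

(** Dominated differentiation with a constant majorant. The derivative is asked for a < x < b only,
    because [C1_on] provides genuine partial derivatives at interior points; the integral is
    therefore moved to the open interval and back. *)
Lemma is_derive_under_integral (R : realType) (f f2 : R -> R -> R)
    (a b t0 r M : R) :
  0 < r ->
  (forall t, t0 - r < t < t0 + r ->
     (@lebesgue_measure R).-integrable `[a, b] (EFin \o f ^~ t)) ->
  (forall x t, a < x < b -> t0 - r < t < t0 + r ->
     is_derive t 1 (f x) (f2 x t)) ->
  (forall x t, a < x < b -> t0 - r < t < t0 + r -> `|f2 x t| <= M) ->
  {within `[a, b], continuous (f2 ^~ t0)} ->
  is_derive t0 1 (fun t => \int[@lebesgue_measure R]_(x in `[a, b]) f x t)
    (\int[@lebesgue_measure R]_(x in `[a, b]) f2 x t0).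
Proof.
move=> r0 fi df fM cf2.
have oc (g : R -> R) : (@lebesgue_measure R).-integrable `[a, b] (EFin \o g) ->
    \int[@lebesgue_measure R]_(x in `]a, b[) g x
    = \int[@lebesgue_measure R]_(x in `[a, b]) g x.
  move=> gi; rewrite Rintegral_itv_bndo_bndc.
    rewrite Rintegral_itv_obnd_cbnd //.
    by apply: integrableS gi => //; exact: subset_itv_oc_cc.
  by apply: integrableS gi => //; exact: subset_itv_oo_cc.
have tI : t0 - r < t0 < t0 + r by rewrite ltrDl gtrBl r0.
rewrite -(oc (f2 ^~ t0)); last first.
  by apply: continuous_compact_integrable; [exact: segment_compact | exact: cf2].
have E t x : x \in `]a, b[%classic -> t0 - r < t < t0 + r ->
    partial1of2 (fun t x => f x t) t x = f2 x t.
  rewrite inE /= in_itv /= => xab /(df _ _ xab) D.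
  by rewrite partial1of2E derive_val.
have -> : \int[@lebesgue_measure R]_(x in `]a, b[) f2 x t0
    = \int[@lebesgue_measure R]_(x in `]a, b[) partial1of2 (fun t x => f x t) t0 x.
  by apply: eq_Rintegral => x xab; rewrite E.
apply: is_derive_of_cvg.
have mI : measurable (`]a, b[%classic : set R) by [].
have tI' : (`]t0 - r, t0 + r[%classic : set R) t0 by rewrite /= in_itv.
have D := @cvg_differentiation_under_integral R _ _ (@lebesgue_measure R)
  (fun t x => f x t) `]a, b[%classic mI t0 (t0 - r) (t0 + r) tI' _ _ (cst `|M|).
have {D}/= D := D _ _ _ _ _.
apply: cvg_trans (D _ _ _ _ _).
- apply: near_eq_cvg; near=> h; rewrite /GRing.scale /= (addrC h t0) !oc //.
  + exact: fi.
  + by apply: fi; rewrite !ltrD2l -ltr_norml; near: h; apply: dnbhs0_lt.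
- move=> t; rewrite in_itv /= => /fi; apply: integrableS => //.
  exact: subset_itv_oo_cc.
- move=> t x; rewrite !in_itv /= => tJ xab.
  by have [] := df _ _ xab tJ.
- by move=> _; exact: normr_ge0.
- have : (@lebesgue_measure R).-integrable `[a, b] (EFin \o cst `|M|).
    apply: continuous_compact_integrable; first exact: segment_compact.
    by apply: continuous_subspaceT => x; exact: cvg_cst.
  by apply: integrableS => //; exact: subset_itv_oo_cc.
- move=> t x; rewrite in_itv /= => tJ xab; rewrite E ?inE //.
  by rewrite (le_trans (fM _ _ _ tJ)) ?ler_norm //; move: xab; rewrite /= in_itv.
Unshelve. all: by end_near. Qed.

(** The integral is a function of two variables, upper limit and parameter, restricted to the
    diagonal, so the chain rule along a line applies. *)
Lemma Leibniz_integral (R : realType) (f f2 : R -> R -> R) (a y : R) :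
  a < y ->
  continuous (fun p : R * R => f p.1 p.2) ->
  continuous (fun p : R * R => f2 p.1 p.2) ->
  (forall x t : R, is_derive t 1 (f x) (f2 x t)) ->
  is_derive y 1 (fun t => \int[@lebesgue_measure R]_(x in `[a, t]) f x t)
    (f y y + \int[@lebesgue_measure R]_(x in `[a, y]) f2 x y).
Proof.
move=> ay cf cf2 df.
have slice t : continuous (f ^~ t).
  move=> x; apply: (@continuous_comp _ _ _ (fun x => (x, t))
    (fun p : R * R => f p.1 p.2)); last exact: cf.
  by apply: (@cvg_pair _ _ _ _ (nbhs x) (nbhs t)); [exact: cvg_id | exact: cvg_cst].
have slice2 t : continuous (f2 ^~ t).
  move=> x; apply: (@continuous_comp _ _ _ (fun x => (x, t))
    (fun p : R * R => f2 p.1 p.2)); last exact: cf2.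
  by apply: (@cvg_pair _ _ _ _ (nbhs x) (nbhs t)); [exact: cvg_id | exact: cvg_cst].
have int t b : (@lebesgue_measure R).-integrable `[a, b] (EFin \o f ^~ t).
  apply: continuous_compact_integrable; first exact: segment_compact.
  exact: continuous_subspaceT.
pose F p t := \int[@lebesgue_measure R]_(x in `[a, p]) f x t.
have -> : (fun t => \int[@lebesgue_measure R]_(x in `[a, t]) f x t)
    = (fun t => F (0 + 1 * t) (0 + 1 * t)).
  by apply/funext => t; rewrite !mul1r !add0r.
have -> : f y y + \int[@lebesgue_measure R]_(x in `[a, y]) f2 x y
    = 1 * f (0 + 1 * y) (0 + 1 * y)
      + 1 * \int[@lebesgue_measure R]_(x in `[a, y]) f2 x y.
  by rewrite !mul1r !add0r.
apply: is_derive_line; rewrite !mul1r !add0r.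
- have : nbhs ((y, y) : R * R) (fst @^-1` [set x : R | a < x]).
    apply: open_nbhs_nbhs; split => //; apply: open_comp; last exact: open_gt.
    by move=> p _; exact: cvg_fst.
  apply: filterS => -[p t] /= ap.
  apply: (@is_derive_integral _ _ _ _ (p + 1)); first by rewrite ap ltrDl ltr01.
    exact: int.
  exact: slice.
- exact: cf.
- have [|M M0 HM] := @continuous_rectangle_bounded R f2 a y (y - 1) (y + 1).
    exact: continuous_subspaceT.
  apply: (@is_derive_under_integral _ _ _ _ _ _ 1 M) => //.
  + by move=> x t /andP[ax xy] /andP[t1 t2]; apply: HM; rewrite !ltW.
  + exact: continuous_subspaceT.
Qed.

(** The second difference of [f] over a small square of side [s], evaluated by the mean value
    theorem in either order of the variables, is s^2 times a value of [f12] and s^2 times a value of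
    [f21], both taken near (x, y). *)
Lemma mixed_partials_eq (R : realType) (f f1 f2 f12 f21 : R -> R -> R) (x y : R) :
  nbhs ((x, y) : R * R) (fun p : R * R =>
    [/\ is_derive p.1 1 (f ^~ p.2) (f1 p.1 p.2),
        is_derive p.2 1 (f p.1) (f2 p.1 p.2),
        is_derive p.2 1 (f1 p.1) (f12 p.1 p.2)
      & is_derive p.1 1 (f2 ^~ p.2) (f21 p.1 p.2)]) ->
  {for (x, y), continuous (fun p : R * R => f12 p.1 p.2)} ->
  {for (x, y), continuous (fun p : R * R => f21 p.1 p.2)} ->
  f12 x y = f21 x y.
Proof.
move=> dn c12 c21.
apply/eqP; rewrite -subr_eq0 -normr_le0; apply/ler_addgt0Pl => e e0; rewrite addr0.
have e2 : 0 < e / 2 by rewrite divr_gt0.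
have /cvgrPdist_lt /(_ _ e2) n12 := c12.
have /cvgrPdist_lt /(_ _ e2) n21 := c21.
have /nbhs_ballP[r /= r0 Hr] : nbhs ((x, y) : R * R) (fun p : R * R =>
    [/\ is_derive p.1 1 (f ^~ p.2) (f1 p.1 p.2),
        is_derive p.2 1 (f p.1) (f2 p.1 p.2),
        is_derive p.2 1 (f1 p.1) (f12 p.1 p.2)
      & is_derive p.1 1 (f2 ^~ p.2) (f21 p.1 p.2)] /\
    (`|f12 x y - f12 p.1 p.2| < e / 2 /\ `|f21 x y - f21 p.1 p.2| < e / 2)).
  by apply: filterI; [exact: dn | apply: filterI; [exact: n12 | exact: n21]].
pose s := r / 2; have s0 : 0 < s by rewrite divr_gt0.
have B p q : x <= p <= x + s -> y <= q <= y + s ->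
    ball ((x, y) : R * R) r ((p, q) : R * R).
  move=> /andP[p1 p2] /andP[q1 q2]; have sr : s < r by rewrite /s; lra.
  by split => /=; rewrite /ball /= ler0_norm; lra.
have [|||p1] := @MVT_segment R (fun p => f p (y + s) - f p y)
    (fun p => f1 p (y + s) - f1 p y) x (x + s).
- by rewrite lerDl ltW.
- move=> p; rewrite in_itv /= => /andP[/ltW p1 /ltW p2].
  have /Hr[[D1 _ _ _] _] := B p (y + s) ltac:(by rewrite p1) ltac:(by rewrite lerDl lexx ltW).
  have /Hr[[D2 _ _ _] _] := B p y ltac:(by rewrite p1) ltac:(by rewrite lerDl lexx ltW).
  exact: is_deriveB.
- apply: derivable_within_continuous => p; rewrite in_itv /= => /andP[p1 p2].
  have /Hr[[D1 _ _ _] _] := B p (y + s) ltac:(by rewrite p1) ltac:(by rewrite lerDl lexx ltW).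
  have /Hr[[D2 _ _ _] _] := B p y ltac:(by rewrite p1) ltac:(by rewrite lerDl lexx ltW).
  by apply: is_derive_derivable; exact: is_deriveB.
rewrite in_itv /= => pI pE.
have [|||q1] := @MVT_segment R (f1 p1) (f12 p1) y (y + s).
- by rewrite lerDl ltW.
- move=> q; rewrite in_itv /= => /andP[/ltW q1 /ltW q2].
  by have /Hr[[_ _ D _] _] := B p1 q pI ltac:(by rewrite q1).
- apply: derivable_within_continuous => q; rewrite in_itv /= => qI.
  have /Hr[[_ _ D _] _] := B p1 q pI qI; exact: is_derive_derivable D.
rewrite in_itv /= => qI qE.
have [|||q2] := @MVT_segment R (fun q => f (x + s) q - f x q)
    (fun q => f2 (x + s) q - f2 x q) y (y + s).
- by rewrite lerDl ltW.
- move=> q; rewrite in_itv /= => /andP[/ltW p2 /ltW p3].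
  have /Hr[[_ D1 _ _] _] := B (x + s) q ltac:(by rewrite lerDl lexx ltW) ltac:(by rewrite p2).
  have /Hr[[_ D2 _ _] _] := B x q ltac:(by rewrite lerDl lexx ltW) ltac:(by rewrite p2).
  exact: is_deriveB.
- apply: derivable_within_continuous => q; rewrite in_itv /= => /andP[p2 p3].
  have /Hr[[_ D1 _ _] _] := B (x + s) q ltac:(by rewrite lerDl lexx ltW) ltac:(by rewrite p2).
  have /Hr[[_ D2 _ _] _] := B x q ltac:(by rewrite lerDl lexx ltW) ltac:(by rewrite p2).
  by apply: is_derive_derivable; exact: is_deriveB.
rewrite in_itv /= => q2I q2E.
have [|||p2] := @MVT_segment R (f2 ^~ q2) (f21 ^~ q2) x (x + s).
- by rewrite lerDl ltW.
- move=> p; rewrite in_itv /= => /andP[/ltW p3 /ltW p4].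
  by have /Hr[[_ _ _ D] _] := B p q2 ltac:(by rewrite p3) q2I.
- apply: derivable_within_continuous => p; rewrite in_itv /= => p3.
  have /Hr[[_ _ _ D] _] := B p q2 p3 q2I; exact: is_derive_derivable D.
rewrite in_itv /= => p2I p2E.
have /Hr[_ [/= H1 _]] := B p1 q1 pI qI.
have /Hr[_ [_ /= H2]] := B p2 q2 p2I q2I.
have E : f12 p1 q1 = f21 p2 q2.
  apply: (@mulIf _ (s * s)); first by rewrite mulf_neq0 // gt_eqF.
  by move: pE q2E; rewrite qE p2E; lra.
rewrite (_ : _ - _ = (f12 x y - f12 p1 q1) - (f21 x y - f21 p2 q2)); last by rewrite E; ring.
apply: le_trans (ler_normB _ _) _; lra.
Qed.

(** The product is dominated by K^2 + w^2. *)
Lemma L2_01_integrableM (R : realType) (K w : R -> R) :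
  {within `[(0 : R), 1], continuous K} -> L2_01 w ->
  (@lebesgue_measure R).-integrable `[(0 : R), 1] (EFin \o (fun x => K x * w x)).
Proof.
move=> cK [mw iw].
have mK : measurable_fun `[(0 : R), 1] K by exact: subspace_continuous_measurable_fun.
have iK : (@lebesgue_measure R).-integrable `[(0 : R), 1] (EFin \o (fun x => K x * K x)).
  apply: continuous_compact_integrable; first exact: segment_compact.
  by move=> x; apply: continuousM; exact: cK.
have ig := integrableD _ iK iw.
apply: le_integrable (ig _) => //.
- by apply/measurable_EFinP; apply: measurable_funM.
- move=> x _; rewrite -EFinD /= lee_fin [X in _ <= X]ger0_norm.
    rewrite ler_norml; have := sqr_ge0 (K x + w x); have := sqr_ge0 (K x - w x).
    have := sqr_ge0 (K x); have := sqr_ge0 (w x).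
    by rewrite !expr2 => *; apply/andP; split; nra.
  by rewrite addr_ge0 // ?sqr_ge0 // -expr2 sqr_ge0.
Qed.

(** With c the integral itself, the pointwise bound 2 c K w <= c^2 + M^2 w^2 integrates over an
    interval of length one to 2 c^2 <= c^2 + M^2 |w|^2. *)
Lemma sqr_integralM_le (R : realType) (K w : R -> R) (M : R) :
  0 < M -> {within `[(0 : R), 1], continuous K} ->
  (forall x, 0 <= x <= 1 -> `|K x| <= M) -> L2_01 w ->
  (\int[@lebesgue_measure R]_(x in `[(0 : R), 1]) (K x * w x)) ^+ 2
    <= M ^+ 2 * L2norm_sq w.
Proof.
move=> M0 cK KM w2; have iKw := L2_01_integrableM _ _ _ cK w2.
set c := \int[_]_(_ in _) _.
have : 2 * c * c <= c ^+ 2 + M ^+ 2 * L2norm_sq w.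
  have iw : (@lebesgue_measure R).-integrable `[(0 : R), 1]
      (EFin \o (fun x => M ^+ 2 * w x ^+ 2)).
    rewrite (_ : _ \o _ = fun x => ((M ^+ 2)%:E * (w x ^+ 2)%:E)%E) //.
    by apply: integrableZl => //; exact: w2.2.
  have ic : (@lebesgue_measure R).-integrable `[(0 : R), 1] (EFin \o cst (c ^+ 2)).
    apply: continuous_compact_integrable; first exact: segment_compact.
    by apply: continuous_subspaceT => x; exact: cvg_cst.
  rewrite {2}/c -RintegralZl // /L2norm_sq -RintegralZl //; last exact: w2.2.
  have -> : c ^+ 2 = \int[@lebesgue_measure R]_(x in `[(0 : R), 1]) c ^+ 2.
    rewrite Rintegral_cst // (_ : fine _ = 1) ?mulr1 //.
    have H := @lebesgue_measure_itv R `[0, 1].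
    rewrite /= lte_fin ltr01 oppr0 adde0 in H; exact: (congr1 fine H).
  rewrite -RintegralD //.
  apply: le_Rintegral => //.
  - rewrite (_ : _ \o _ = fun x => ((2 * c)%:E * (K x * w x)%:E)%E) //.
    exact: integrableZl.
  - have H := integrableD _ ic iw; exact: H.
  - move=> x; rewrite /= in_itv /= => /KM; rewrite ler_norml => /andP[K1 K2].
    have : (K x * w x) ^+ 2 <= (M * w x) ^+ 2.
      by rewrite !exprMn ler_wpM2r ?sqr_ge0 //; nra.
    have := sqr_ge0 (c - K x * w x); rewrite !exprMn.
    nra.
nra.
Qed.

Lemma normr_integral_le (R : realType) (f : R -> R) (a b M : R) :
  a <= b -> (@lebesgue_measure R).-integrable `[a, b] (EFin \o f) ->
  (forall x, a <= x <= b -> `|f x| <= M) ->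
  `|\int[@lebesgue_measure R]_(x in `[a, b]) f x| <= M * (b - a).
Proof.
move=> ab fi fM; apply: le_trans (le_normr_Rintegral _ _) _ => //.
have -> : M * (b - a) = \int[@lebesgue_measure R]_(x in `[a, b]) M.
  rewrite Rintegral_cst // (_ : fine _ = b - a) //.
  have H := @lebesgue_measure_itv R `[a, b]; rewrite /= lte_fin in H.
  have {}H := congr1 fine H; apply: etrans H _.
  by case: ltP => //= ba; have -> : a = b by [apply/eqP; rewrite eq_le ab]; rewrite subrr.
apply: le_Rintegral => //.
- exact: (integrable_norm fi).
- apply: continuous_compact_integrable; first exact: segment_compact.
  by apply: continuous_subspaceT => x; exact: cvg_cst.
Qed.

(** * The Bessel factor of [Psi] *)

Section bessel.
Context {R : realType}.
Implicit Types (c : R^nat) (w x : R).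

Lemma is_cvg_normed_pseries c x : (forall k, `|c k| <= (k`!%:R)^-1) ->
  cvgn [normed pseries c x].
Proof.
move=> cb; apply: (@series_le_cvg _ _ (exp_coeff `|x|)).
- by move=> n /=; exact: normr_ge0.
- by move=> n; rewrite /exp_coeff /= divr_ge0 // exprn_ge0.
- move=> n; rewrite /exp_coeff /= normrM normrX mulrC.
  by apply: ler_wpM2l; rewrite ?exprn_ge0.
- exact: is_cvg_series_exp_coeff.
Qed.

Lemma is_cvg_pseries_fact c x : (forall k, `|c k| <= (k`!%:R)^-1) ->
  cvgn (pseries c x).
Proof. by move=> cb; apply: normed_cvg; exact: is_cvg_normed_pseries. Qed.

Lemma normr_pseries_le c x : (forall k, `|c k| <= (k`!%:R)^-1) ->
  `|limn (pseries c x)| <= expR `|x|.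
Proof.
move=> cb; apply: le_trans (lim_series_norm _) _.
  exact: is_cvg_normed_pseries.
apply: lim_series_le.
- exact: is_cvg_normed_pseries.
- exact: is_cvg_series_exp_coeff.
- move=> n; rewrite /exp_coeff /= normrM normrX mulrC.
  by apply: ler_wpM2l; rewrite ?exprn_ge0.
Qed.

(** Coefficients of I_1(s)/s as a power series in w = s^2; in this variable the square root in [Psi]
    disappears, and with it the singular point s = 0. *)
Definition bessel_coef (k : nat) : R := (1 / 2) / (4 ^+ k * (k`! * (k.+1)`!)%:R).

(** [besselD j] is the [j]-th derivative of the entire function
    w |-> I_1(sqrt w) / sqrt w. *)
Definition besselD (j : nat) w : R :=
  limn (pseries (iter j (@pseries_diffs R) bessel_coef) w).

(** Differentiation sends c_k to (k+1) c_(k+1), which reproduces the bound 1/k!. Hence every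
    derivative has the same majorant exp |w|. *)
Lemma besselD_coef_le j k :
  `|iter j (@pseries_diffs R) bessel_coef k| <= (k`!%:R)^-1.
Proof.
elim: j k => [|j IHj] k.
  rewrite /= /bessel_coef ger0_norm; last first.
    by rewrite divr_ge0 // mulr_ge0 // exprn_ge0.
  have -> : (1 / 2) / (4 ^+ k * (k`! * (k.+1)`!)%:R)
      = (k`!%:R)^-1 * ((1 / 2) * ((4 ^+ k)^-1 * ((k.+1)`!%:R)^-1)) :> R.
    by rewrite natrM !invfM; ring.
  apply: ler_piMr; first by rewrite invr_ge0.
  have H1 : (4 ^+ k)^-1 <= 1 :> R.
    by rewrite invf_le1 ?exprn_gt0 // exprn_ege1 // ler1n.
  have H2 : ((k.+1)`!%:R)^-1 <= 1 :> R by rewrite invf_le1 ?ltr0n ?ler1n fact_gt0.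
  have H3 : 0 <= (4 ^+ k)^-1 :> R by rewrite invr_ge0 exprn_ge0.
  have H4 : 0 <= ((k.+1)`!%:R)^-1 :> R by rewrite invr_ge0.
  nra.
rewrite iterS /pseries_diffs normrM ger0_norm //.
rewrite mulrC -ler_pdivlMr ?ltr0n // (le_trans (IHj _)) //.
by rewrite factS natrM invfM mulrC.
Qed.

Lemma is_derive_besselD j w : is_derive w 1 (besselD j) (besselD j.+1 w).
Proof.
pose K : R := `|w| + 1.
apply: (@pseries_snd_diffs R _ K).
- by apply: is_cvg_pseries_fact; exact: besselD_coef_le.
- by rewrite -iterS; apply: is_cvg_pseries_fact; exact: besselD_coef_le.
- by rewrite -!iterS; apply: is_cvg_pseries_fact; exact: besselD_coef_le.
- by rewrite (ger0_norm (_ : 0 <= K)) ?addr_ge0 // ltrDl.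
Qed.

Lemma normr_besselD_le j w : `|besselD j w| <= expR `|w|.
Proof. by apply: normr_pseries_le; exact: besselD_coef_le. Qed.

Lemma besselI1_div_sqrt w : 0 <= w -> besselI1_div (Num.sqrt w) = besselD 0 w.
Proof.
move=> w0; rewrite /besselI1_div; case: ifPn => [|s0].
  rewrite sqrtr_eq0 => w0'; have {w0 w0'} -> : w = 0.
    by apply/eqP; rewrite eq_le w0 w0'.
  rewrite /besselD /=; apply/esym/cvg_lim => //.
  apply: cvg_near_cst; exists 1%N => // n /= n0.
  rewrite /pseries /series /= big_ltn // big1_seq ?addr0.
    by rewrite expr0 mulr1 /bessel_coef expr0 !fact0 factS !muln1 !mulr1 divr1.
  move=> i /=; rewrite mem_index_iota => /andP[i0 _].
  by rewrite expr0n gtn_eqF ?mulr0.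
rewrite /besselI1 /besselD /=.
have E : (series (fun k : nat => (Num.sqrt w / 2) ^+ (2 * k + 1) / (k`! * (k.+1)`!)%:R))
  = (fun n => Num.sqrt w * pseries bessel_coef w n).
  apply/funext => n; rewrite /pseries /series /= mulr_sumr; apply: eq_bigr => k _.
  rewrite /bessel_coef addn1 exprS exprM.
  have -> : (Num.sqrt w / 2) ^+ 2 = w / 4.
    rewrite expr_div_n sqr_sqrtr //; congr (_ / _); ring.
  rewrite expr_div_n; field.
  by rewrite !pnatr_eq0 -!lt0n !fact_gt0 expf_neq0 // pnatr_eq0.
rewrite E; have C : cvgn (pseries bessel_coef w).
  by apply: is_cvg_pseries_fact; exact: (besselD_coef_le 0).
rewrite (_ : limn _ = Num.sqrt w * limn (pseries bessel_coef w)).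
  by rewrite mulrC mulKf.
by apply: cvg_lim => //; apply: cvgM; [exact: cvg_cst | exact: C].
Qed.

End bessel.

(** * The kernel [h] *)

Lemma within_continuous_interior (R : realType) (D : set (R * R))
    (f : R -> R -> R) (x y : R) :
  {within D, continuous (fun p : R * R => f p.1 p.2)} ->
  interior D (x, y) -> {for (x, y), continuous (fun p : R * R => f p.1 p.2)}.
Proof.
move=> /subspace_continuousP cf Dxy.
have := cf _ (interior_subset Dxy); by rewrite within_interior.
Qed.

Lemma interior_triangle (R : realType) (x y : R) :
  0 < y -> y < x -> x < 1 -> interior triangle (x, y).
Proof.
move=> y0 yx x1.
have r0 : 0 < Num.min y (Num.min ((x - y) / 2) (1 - x)).
  by rewrite !lt_min y0 subr_gt0 x1 divr_gt0 // subr_gt0.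
apply/nbhs_ballP; exists (Num.min y (Num.min ((x - y) / 2) (1 - x))) => //=.
move=> -[x' y'] [/=]; rewrite /ball /= !lt_min !ltr_norml.
move=> /and3P[/andP[a1 a2] /andP[a3 a4] /andP[a5 a6]].
move=> /and3P[/andP[b1 b2] /andP[b3 b4] /andP[b5 b6]].
by split => /=; lra.
Qed.

(** Carries identities found at interior points, where derivatives exist, to the end points: the
    difference is locally zero inside, hence constant on the closed interval. *)
Lemma within_continuous_eq (R : realType) (f g : R -> R) (a b : R) :
  a < b -> {within `[a, b], continuous f} -> {within `[a, b], continuous g} ->
  (forall x, a < x < b -> f x = g x) -> forall x, a <= x <= b -> f x = g x.
Proof.
move=> ab cf cg fg.
have D0 : forall x, a <= x <= b -> f x - g x = f a - g a.
  apply: (@is_derive_0_cst R (fun x => f x - g x)).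
    exact: within_continuousB.
  move=> x xab; apply: (@near_eq_is_derive R R R (cst 0)).
  have : \forall y \near x, y \in `]a, b[ by apply: near_in_itvoo; rewrite in_itv.
  by apply: filterS => y; rewrite in_itv /= => /fg ->; rewrite subrr.
have mab : a < (a + b) / 2 < b by apply/andP; split; lra.
have E : f a - g a = 0.
  rewrite -(D0 ((a + b) / 2)) ?fg ?subrr //.
  by case/andP: mab => m1 m2; rewrite !ltW.
by move=> x /D0; rewrite E => /eqP; rewrite subr_eq0 => /eqP.
Qed.

Lemma within_continuous_reflect (R : realType) (f : R -> R) (x : R) :
  {within `[0, x], continuous f} ->
  {within `[0, x], continuous (fun y => f (x - y))}.
Proof.
move=> cf; apply/subspace_continuousP => y yx.
apply: (@within_continuous_cvg _ _ _ f R _ (fun y => x - y) (x - y) _ cf).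
- by move: yx; rewrite /= !in_itv /= => /andP[? ?]; apply/andP; split; lra.
- apply: cvg_within_filter; apply: cvgB; [exact: cvg_cst | exact: cvg_id].
- rewrite /prop_near1 nbhs_simpl /=; near=> z.
  have : z \in `[0, x] by near: z; apply: withinT.
  by rewrite /= !in_itv /= => /andP[? ?]; apply/andP; split; lra.
Unshelve. all: by end_near. Qed.

(** Needed to shift the reflected argument of the Volterra integral from F, once h(x,y) = F(x-y), to
    the cosine. If P is a primitive of [f], then y |-> - P (x - y) is one of the reflected
    function. *)
Lemma integral_reflect (R : realType) (f : R -> R) (x : R) :
  0 < x -> {within `[0, x], continuous f} ->
  \int[@lebesgue_measure R]_(y in `[0, x]) f (x - y)
  = \int[@lebesgue_measure R]_(y in `[0, x]) f y.
Proof.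
move=> x0 cf.
have fi : (@lebesgue_measure R).-integrable `[0, x] (EFin \o f).
  by apply: continuous_compact_integrable => //; exact: segment_compact.
pose P y := \int[@lebesgue_measure R]_(z in `[0, y]) f z.
have cP : {within `[0, x], continuous P}.
  exact: parameterized_integral_continuous (ltW x0) fi.
transitivity (- P (x - x) - - P (x - 0)); last first.
  by rewrite subrr subr0 opprK {1}/P set_itv1 Rintegral_set1 oppr0 add0r.
apply: (@continuous_FTC2_is_derive R (fun y => f (x - y)) (fun y => - P (x - y))) => //.
- exact: within_continuous_reflect.
- move=> y; apply: cvgN; exact: (within_continuous_reflect _ _ _ cP).
- move=> y /andP[y0 yx].
  have xy : 0 < x - y < x by apply/andP; split; lra.
  have D : is_derive (x - y) 1 P (f (x - y)).
    apply: (@is_derive_integral _ _ _ _ x) => //.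
    by apply: (within_continuous_continuous x0 cf); rewrite in_itv.
  have D2 : is_derive y 1 (fun y => x - y) (-1) by auto_is_derive; ring.
  have D3 := @is_derive1_comp R P (fun y => x - y) y _ _ D D2.
  have := is_deriveN D3; rewrite mulrN1 opprK; exact.
Qed.

(** [x |-> h(x,0)] solves F'' = mu^2 F with F(0) = 0 and F'(0) = - k, where
    mu^2 = a / eps and k = b kappa / eps. *)
Definition kerF {R : realType} (k mu s : R) : R :=
  - k / (2 * mu) * (expR (mu * s) - expR (- (mu * s))).
Definition kerF' {R : realType} (k mu s : R) : R :=
  - k / 2 * (expR (mu * s) + expR (- (mu * s))).

Lemma is_derive_kerF (R : realType) (k mu s : R) : mu != 0 ->
  is_derive s 1 (kerF k mu) (kerF' k mu s).
Proof. by move=> mu0; rewrite /kerF /kerF'; auto_is_derive; field. Qed.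

Lemma is_derive_kerF' (R : realType) (k mu s : R) : mu != 0 ->
  is_derive s 1 (kerF' k mu) (mu ^+ 2 * kerF k mu s).
Proof. by move=> mu0; rewrite /kerF /kerF'; auto_is_derive; field. Qed.

(** The quantities (F1 - m F) exp(m x) for m = mu and m = - mu are constant and equal to - k.
    Together they form an invertible linear system for F and F1. *)
Lemma kerF_unique (R : realType) (F F1 : R -> R) (k mu : R) :
  mu != 0 ->
  {within `[0, 1], continuous F} -> {within `[0, 1], continuous F1} ->
  (forall x : R, 0 < x < 1 -> is_derive x 1 F (F1 x)) ->
  (forall x : R, 0 < x < 1 -> is_derive x 1 F1 (mu ^+ 2 * F x)) ->
  F 0 = 0 -> F1 0 = - k ->
  forall x, 0 <= x <= 1 -> F x = kerF k mu x /\ F1 x = kerF' k mu x.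
Proof.
move=> mu0 cF cF1 dF dF1 F0 F10 x x01.
have H (m : R) : m ^+ 2 = mu ^+ 2 -> (F1 x - m * F x) * expR (m * x) = - k.
  move=> mE.
  rewrite (@is_derive_0_cst R (fun x => (F1 x - m * F x) * expR (m * x)) 0 1 _ _ x x01).
  - by rewrite F0 F10 mulr0 subr0 expR0 mulr1.
  - have ce : {within `[0, 1], continuous (fun x => expR (m * x))}.
      apply: continuous_subspaceT => y.
      by apply: (@is_derive_continuous _ _ _ (expR (m * y) * m)); auto_is_derive; ring.
    move=> y; apply: cvgM; last exact: ce.
    apply: cvgB; first exact: cF1.
    by apply: cvgM; [exact: cvg_cst | exact: cF].
  - move=> y y01; have D := dF _ y01; have D1 := dF1 _ y01.
    by auto_is_derive; rewrite -mE; ring.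
have H1 := H mu erefl; have H2 := H (- mu) (sqrrN _).
have e0 : expR (mu * x) != 0 by rewrite gt_eqF // expR_gt0.
have E : expR (- (mu * x)) = (expR (mu * x))^-1 by rewrite expRN.
rewrite !mulNr E opprK in H2.
have H3 : F1 x - mu * F x = - k * (expR (mu * x))^-1 by rewrite -H1 mulfK.
have H4 : F1 x + mu * F x = - k * expR (mu * x).
  by rewrite -H2 divfK.
rewrite /kerF /kerF' E; split.
  rewrite (_ : F x = ((F1 x + mu * F x) - (F1 x - mu * F x)) / (2 * mu)).
    by rewrite H3 H4; field; rewrite mu0 e0.
  by field.
rewrite (_ : F1 x = ((F1 x + mu * F x) + (F1 x - mu * F x)) / 2).
  by rewrite H3 H4; field.
by field.
Qed.

Section kernel.
Context {R : realType}.
Variables (h hx hy hxx hxy hyx hyy : R -> R -> R).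
Hypothesis Ch : C1_on triangle h hx hy.
Hypothesis Chx : C1_on triangle hx hxx hxy.
Hypothesis Chy : C1_on triangle hy hyx hyy.
Hypothesis wave : forall x y, triangle (x, y) -> hyy x y = hxx x y.
Hypothesis diag : forall x : R, 0 <= x <= 1 -> hy x x + hx x x = 0.
Hypothesis h00 : h 0 0 = 0.

Let ch := let: And4 c _ _ _ := Ch in c.
Let chx := let: And4 c _ _ _ := Chx in c.
Let chy := let: And4 c _ _ _ := Chy in c.
Let dh := let: And4 _ _ _ d := Ch in d.
Let dhx := let: And4 _ _ _ d := Chx in d.
Let dhy := let: And4 _ _ _ d := Chy in d.

Lemma kernel_mixed (x y : R) : interior triangle (x, y) -> hxy x y = hyx x y.
Proof.
move=> Txy; apply: (@mixed_partials_eq R h hx hy).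
- apply: filterS (nbhs_interior Txy) => -[x' y'] /= Txy'.
  by have [? ?] := dh _ _ Txy'; have [? ?] := dhx _ _ Txy'; have [? ?] := dhy _ _ Txy'.
- by case: Chx => _ _ c _; exact: (within_continuous_interior _ _ _ _ _ c).
- by case: Chy => _ c _ _; exact: (within_continuous_interior _ _ _ _ _ c).
Qed.

Lemma within_continuous_line (f : R -> R -> R) (al be x0 y0 a b : R) :
  {within triangle, continuous (fun p : R * R => f p.1 p.2)} ->
  (forall s, a <= s <= b -> triangle (x0 + al * s, y0 + be * s)) ->
  {within `[a, b], continuous (fun s => f (x0 + al * s) (y0 + be * s))}.
Proof.
move=> cf T; apply/subspace_continuousP => s sab.
apply: (@within_continuous_cvg (R * R)%type R triangle (fun p => f p.1 p.2) R _
  (fun s => (x0 + al * s, y0 + be * s)) (x0 + al * s, y0 + be * s) _ cf).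
- by apply: T; move: sab; rewrite /= in_itv.
- have L (z w : R) : (fun s => z + w * s) @ within `[a, b] (nbhs s) --> z + w * s.
    apply: cvg_within_filter; apply: cvgD; first exact: cvg_cst.
    by apply: cvgM; [exact: cvg_cst | exact: cvg_id].
  by apply: (@cvg_pair _ _ _ _ (nbhs (x0 + al * s)) (nbhs (y0 + be * s))); exact: L.
- near=> z; apply: T.
  have : z \in `[a, b] by near: z; apply: withinT.
  by rewrite in_itv.
Unshelve. all: by end_near. Qed.

Lemma is_derive_line_triangle (f f1 f2 : R -> R -> R) (al be x0 y0 s : R) :
  C1_on triangle f f1 f2 ->
  interior triangle (x0 + al * s, y0 + be * s) ->
  is_derive s 1 (fun s => f (x0 + al * s) (y0 + be * s))
    (al * f1 (x0 + al * s) (y0 + be * s) + be * f2 (x0 + al * s) (y0 + be * s)).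
Proof.
move=> [_ c1 _ df] Ts; apply: is_derive_line.
- by have := nbhs_interior Ts; apply: filterS => -[x' y'] /= /df[].
- exact: (within_continuous_interior _ _ _ _ _ c1).
- by have [] := df _ _ Ts.
Qed.

(* [hx + hy] is transported along the characteristics [x + y = const], which
   end on the diagonal, where it vanishes. *)
Lemma kernel_transport (x y : R) : 0 < y -> y < x -> x < 1 ->
  hx x y + hy x y = 0.
Proof.
(* [S] is the parameter at which the characteristic through (x, y) meets the diagonal. *)
move=> y0 yx x1; pose S := (x - y) / 2; have S0 : 0 < S by rewrite divr_gt0 ?subr_gt0.
have T s : 0 <= s <= S -> triangle (x + -1 * s, y + 1 * s).
  by rewrite /S => /andP[s0 s1]; split => /=; lra.
pose G s := hx (x + -1 * s) (y + 1 * s) + hy (x + -1 * s) (y + 1 * s).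
have -> : hx x y + hy x y = G 0 by rewrite /G !mulr0 !addr0.
have -> : G 0 = G S.
  apply/esym/(@is_derive_0_cst R G 0 S); last by rewrite lexx ltW.
  - apply: within_continuousD; apply: within_continuous_line => //.
  - move=> s /andP[s0 s1].
    have Ti : interior triangle (x + -1 * s, y + 1 * s).
      by move: s1; rewrite /S => s1; apply: interior_triangle; lra.
    have D1 := is_derive_line_triangle _ _ _ _ _ _ _ _ Chx Ti.
    have D2 := is_derive_line_triangle _ _ _ _ _ _ _ _ Chy Ti.
    apply: (is_derive_eq (is_deriveD D1 D2)).
    by rewrite (kernel_mixed _ _ Ti) (wave _ _ (interior_subset Ti)); ring.
rewrite /G (_ : x + -1 * S = y + 1 * S); last by rewrite /S; field.
by rewrite addrC diag // /S; apply/andP; split; lra.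
Qed.

Let F x := h x 0.
Let F1 x := hx x 0.

(** Along x - y = d the derivative of h is hx + hy, which vanishes by transport, and that of hx is
    hxx + hxy = hxx + hyx, the x-derivative of hx + hy, which vanishes because hx + hy is zero in a
    neighbourhood. *)
Let line_F (d : R) : 0 < d -> d < 1 ->
  forall s, 0 <= s <= 1 - d ->
  [/\ h (d + 1 * s) (0 + 1 * s) = F d, hx (d + 1 * s) (0 + 1 * s) = F1 d
    & hx (d + 1 * s) (0 + 1 * s) + hy (d + 1 * s) (0 + 1 * s) = 0].
Proof.
move=> d0 d1 s sI.
have T s' : 0 <= s' <= 1 - d -> triangle (d + 1 * s', 0 + 1 * s').
  by move=> /andP[s0 s1]; split => /=; lra.
have Ti s' : 0 < s' < 1 - d -> interior triangle (d + 1 * s', 0 + 1 * s').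
  by move=> /andP[s0 s1]; apply: interior_triangle; lra.
have Z s' : 0 < s' < 1 - d ->
    hx (d + 1 * s') (0 + 1 * s') + hy (d + 1 * s') (0 + 1 * s') = 0.
  by move=> /andP[s0 s1]; apply: kernel_transport; lra.
split.
- transitivity (h (d + 1 * 0) (0 + 1 * 0)); last by rewrite !mulr0 !addr0.
  apply: (@is_derive_0_cst R (fun s => h (d + 1 * s) (0 + 1 * s)) 0 (1 - d)) => //.
    exact: within_continuous_line.
  move=> s' s'I.
  have D := is_derive_line_triangle _ _ _ _ _ _ _ _ Ch (Ti _ s'I).
  by apply: (is_derive_eq D); rewrite -[RHS](Z _ s'I); ring.
- transitivity (hx (d + 1 * 0) (0 + 1 * 0)); last by rewrite !mulr0 !addr0.
  apply: (@is_derive_0_cst R (fun s => hx (d + 1 * s) (0 + 1 * s)) 0 (1 - d)) => //.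
    exact: within_continuous_line.
  move=> s' s'I.
  have D := is_derive_line_triangle _ _ _ _ _ _ _ _ Chx (Ti _ s'I).
  apply: (is_derive_eq D); rewrite (kernel_mixed _ _ (Ti _ s'I)) !mul1r add0r.
  set X := d + s'; set Y := s'.
  have TXY : interior triangle (X, Y) by have := Ti _ s'I; rewrite !mul1r add0r.
  have [D1 _] := dhx _ _ TXY; have [D2 _] := dhy _ _ TXY.
  have D12 := is_deriveD D1 D2.
  rewrite -(@derive_val _ _ _ _ _ _ _ D12).
  rewrite (_ : 0 = 'D_1 (cst 0 : R -> R) X); last by rewrite derive_cst.
  apply: near_eq_derive.
  have XI : X \in `]Y, 1[ by case/andP: s'I => ? ?; rewrite in_itv /= /X /Y; apply/andP; split; lra.
  have := near_in_itvoo XI; apply: filterS => z; rewrite in_itv /= => /andP[Yz z1].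
  by apply: kernel_transport => //; case/andP: s'I.
- apply: (@within_continuous_eq R (fun s => hx (d + 1 * s) (0 + 1 * s)
      + hy (d + 1 * s) (0 + 1 * s)) (cst 0) 0 (1 - d)) => //.
  + by rewrite subr_gt0.
  + by apply: within_continuousD; apply: within_continuous_line.
  + by apply: continuous_subspaceT => z; exact: cvg_cst.
Qed.

Lemma kernel_diff (x y : R) : 0 <= y -> y < x -> x <= 1 ->
  h x y = F (x - y) /\ hx x y = F1 (x - y).
Proof.
move=> y0 yx x1.
(* The line x - y = 1 degenerates to the corner (1, 0), where the claim is trivial. *)
have [|d1] := ltP (x - y) 1; last first.
  have -> : x = 1 by lra.
  have -> : y = 0 by lra.
  by rewrite !subr0.
move=> d1; have d0 : 0 < x - y by rewrite subr_gt0.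
have [|H1 H2 _] := line_F _ d0 d1 y; first by apply/andP; split; lra.
by move: H1 H2; rewrite !mul1r add0r subrK.
Qed.

Lemma kernel_hy0 (x : R) : 0 < x -> x < 1 -> hy x 0 = - F1 x.
Proof.
move=> x0 x1; have [|_ _] := line_F _ x0 x1 0; first by rewrite lexx subr_ge0 ltW.
by rewrite !mulr0 !addr0 => H; apply/eqP; rewrite -subr_eq0 opprK addrC H.
Qed.

Lemma kernel_trace_within :
  {within `[0, 1], continuous F} /\ {within `[0, 1], continuous F1}.
Proof.
have T (x : R) : `[0, 1]%classic x -> triangle (x, 0 : R).
  by rewrite /= in_itv /= => /andP[x0 x1]; split.
by split; [apply: (within_continuous_slice1 _ _ _ _ _ ch)
  | apply: (within_continuous_slice1 _ _ _ _ _ chx)].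
Qed.

(** The side y = 0 lies outside the interior, so [C1_on] gives no derivative there. Since h(x, 0) =
    h(x + s, s), the derivative is read off at an interior point of the same line. *)
Lemma is_derive_kernel_trace (x : R) : 0 < x < 1 -> is_derive x 1 F (F1 x).
Proof.
move=> /andP[x0 x1]; pose s := (1 - x) / 2.
have s0 : 0 < s by rewrite divr_gt0 ?subr_gt0.
have xs : x + s < 1 by rewrite /s; lra.
have [|_ E _] := line_F _ x0 x1 s; first by apply/andP; split; lra.
rewrite !mul1r add0r in E.
have sx : s < x + s by rewrite ltrDr.
have [D _] := dh _ _ (interior_triangle _ _ _ s0 sx xs).
have D2 : is_derive x 1 (fun z => z + s) 1 by auto_is_derive; ring.
have D3 := @is_derive1_comp R (h ^~ s) (fun z => z + s) x _ _ D D2.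
rewrite mulr1 E in D3; apply: near_eq_is_derive D3.
have xI : x \in `]0, 1 - s[ by rewrite in_itv /= x0; lra.
have := near_in_itvoo xI; apply: filterS => z; rewrite in_itv /= => /andP[z0 z1].
have [] := kernel_diff (z + s) s; rewrite ?addrK //; lra.
Qed.

End kernel.

Lemma continuous_cos_affine (R : realType) (w c : R) :
  continuous (fun s : R => cos (w * s + c)).
Proof.
by move=> s; apply: is_derive_continuous; auto_is_derive; reflexivity.
Qed.

Lemma continuous_sin_affine (R : realType) (w c : R) :
  continuous (fun s : R => sin (w * s + c)).
Proof.
by move=> s; apply: is_derive_continuous; auto_is_derive; reflexivity.
Qed.

(** The condition at y = 0 is a convolution of F with a cosine of frequency w. The addition formula
    reduces it to the two integrals [P] and [Q]; eliminating them leaves F'' = (k - w^2) F, and w^2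
    = (b kappa - a)/eps makes k - w^2 equal to a/eps. The diagonal point y = 1 is reached by
    continuity. *)
Lemma kernel_explicit (R : realType) (eps b kappa : R) (th : R * R)
    (h hx : R -> R -> R) :
  0 < eps -> 0 < th.2 -> th.2 < b * kappa ->
  kernel_solution eps b kappa th h hx ->
  forall y, 0 <= y <= 1 ->
    h 1 y = kerF (b * kappa / eps) (Num.sqrt (th.2 / eps)) (1 - y) /\
    hx 1 y = kerF' (b * kappa / eps) (Num.sqrt (th.2 / eps)) (1 - y).
Proof.
move=> eps0 a0 abk [hy [hxx [hxy [hyx [hyy [Ch Chx Chy [volt wave diag h00]]]]]]].
set k := b * kappa / eps; set mu := Num.sqrt _.
have mu0 : 0 < mu by rewrite sqrtr_gt0 divr_gt0.
have mu2 : mu ^+ 2 = th.2 / eps by rewrite sqr_sqrtr // ltW // divr_gt0.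
pose w := Num.sqrt ((b * kappa - th.2) / eps).
have w2 : w ^+ 2 = (b * kappa - th.2) / eps.
  by rewrite sqr_sqrtr // ltW // divr_gt0 // subr_gt0.
pose F x := h x 0; pose F1 x := hx x 0.
have [cF cF1] : {within `[0, 1], continuous F} /\ {within `[0, 1], continuous F1}.
  exact: (kernel_trace_within _ _ _ _ _ Ch Chx).
have dF (x : R) : 0 < x < 1 -> is_derive x 1 F (F1 x).
  exact: (is_derive_kernel_trace _ _ _ _ _ _ _ Ch Chx Chy).
have cos_c : continuous (fun s => cos (w * s)).
  by move=> s; have := @continuous_cos_affine R w 0 s; under eq_fun do rewrite addr0.
have sin_c : continuous (fun s => sin (w * s)).
  by move=> s; have := @continuous_sin_affine R w 0 s; under eq_fun do rewrite addr0.
have cFc : {within `[0, 1], continuous (fun s => F s * cos (w * s))}.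
  by move=> s; apply: cvgM; [exact: cF | exact: (continuous_subspaceT cos_c)].
have cFs : {within `[0, 1], continuous (fun s => F s * sin (w * s))}.
  by move=> s; apply: cvgM; [exact: cF | exact: (continuous_subspaceT sin_c)].
have int (f : R -> R) (x : R) : x <= 1 -> {within `[0, 1], continuous f} ->
    (@lebesgue_measure R).-integrable `[0, x] (EFin \o f).
  move=> x1 cf; apply: continuous_compact_integrable; first exact: segment_compact.
  by apply: continuous_subspaceW cf; apply: subset_itvl; rewrite bnd_simp.
pose P x := \int[@lebesgue_measure R]_(s in `[0, x]) (F s * cos (w * s)).
pose Q x := \int[@lebesgue_measure R]_(s in `[0, x]) (F s * sin (w * s)).
have dint (f : R -> R) (x : R) : 0 < x < 1 -> {within `[0, 1], continuous f} ->
    is_derive x 1 (fun x => \int[@lebesgue_measure R]_(s in `[0, x]) f s) (f x).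
  move=> x01 cf; apply: (@is_derive_integral _ _ _ _ 1) => //; first exact: int.
  by apply: (within_continuous_continuous ltr01 cf); rewrite in_itv.
have dP (x : R) (x01 : 0 < x < 1) : is_derive x 1 P _ := dint _ x x01 cFc.
have dQ (x : R) (x01 : 0 < x < 1) : is_derive x 1 Q _ := dint _ x x01 cFs.
have cP : {within `[0, 1], continuous P}.
  by apply: parameterized_integral_continuous => //; exact: int.
have cQ : {within `[0, 1], continuous Q}.
  by apply: parameterized_integral_continuous => //; exact: int.
have P0 : P 0 = 0 by rewrite /P set_itv1 Rintegral_set1.
have Q0 : Q 0 = 0 by rewrite /Q set_itv1 Rintegral_set1.
(* This is the boundary condition divided by eps, with hy(x, 0) = - F1(x) from the transport
   identity. *)
have F1E : forall x, 0 <= x <= 1 ->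
    F1 x = k * (cos (w * x) * (P x - 1) + sin (w * x) * Q x).
  apply: within_continuous_eq => //.
    move=> s; apply: cvgM; first exact: cvg_cst.
    apply: cvgD; apply: cvgM.
    - exact: (continuous_subspaceT cos_c).
    - by apply: cvgB; [exact: cP | exact: cvg_cst].
    - exact: (continuous_subspaceT sin_c).
    - exact: cQ.
  move=> x /andP[x0 x1].
  have := volt x; rewrite (ltW x0) (ltW x1) => /(_ isT).
  rewrite (kernel_hy0 _ _ _ _ _ _ _ Ch Chx Chy wave diag) //.
  have cFx : {within `[0, x], continuous F}.
    by apply: continuous_subspaceW cF; apply: subset_itvl; rewrite bnd_simp ltW.
  have E : forall y, 0 <= y <= x -> h x y = F (x - y).
    apply: within_continuous_eq => //.
    - case: Ch => c _ _ _; apply: (within_continuous_slice2 _ _ _ _ _ c) => y.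
      by rewrite /= in_itv /= => /andP[? ?]; split => //=; exact: ltW.
    - exact: within_continuous_reflect.
    - move=> y /andP[y0 yx].
      by have [] := kernel_diff _ _ _ _ _ _ _ Ch Chx Chy wave diag x y (ltW y0) yx (ltW x1).
  have -> : \int[@lebesgue_measure R]_(y in `[0, x]) (h x y * gamma eps b kappa th y)
      = - kappa * (cos (w * x) * P x + sin (w * x) * Q x).
    pose g s := F s * (- kappa * cos (- w * s + w * x)).
    transitivity (\int[@lebesgue_measure R]_(y in `[0, x]) g (x - y)).
      apply: eq_Rintegral => y; rewrite inE /= in_itv /= => yI.
      rewrite E // /gamma -/w /g; congr (_ * (_ * cos _)); ring.
    rewrite (integral_reflect _ g) //; last first.
      move=> s; apply: cvgM; first exact: cFx.
      apply: cvgM; first exact: cvg_cst.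
      exact: (continuous_subspaceT (continuous_cos_affine R (- w) (w * x))).
    transitivity (\int[@lebesgue_measure R]_(s in `[0, x])
       ((- kappa * cos (w * x)) * (F s * cos (w * s))
        + (- kappa * sin (w * x)) * (F s * sin (w * s)))).
      apply: eq_Rintegral => s _.
      rewrite /g (_ : - w * s + w * x = w * x - w * s) ?cosB; ring.
    have ic : (@lebesgue_measure R).-integrable `[0, x]
      (EFin \o (fun s => (- kappa * cos (w * x)) * (F s * cos (w * s)))).
      apply: int; first exact: ltW.
      by move=> s; apply: cvgM; [exact: cvg_cst | exact: cFc].
    have isn : (@lebesgue_measure R).-integrable `[0, x]
      (EFin \o (fun s => (- kappa * sin (w * x)) * (F s * sin (w * s)))).
      apply: int; first exact: ltW.
      by move=> s; apply: cvgM; [exact: cvg_cst | exact: cFs].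
    rewrite RintegralD // !RintegralZl //; first by rewrite /P /Q; ring.
    - by apply: int => //; exact: ltW.
    - by apply: int => //; exact: ltW.
  rewrite /gamma -/w -/(F1 x) => H.
  have -> : F1 x = (eps * F1 x) / eps by field; rewrite gt_eqF.
  have -> : eps * F1 x = b * (- kappa * cos (w * x))
     - b * (- kappa * (cos (w * x) * P x + sin (w * x) * Q x)) by lra.
  by rewrite /k; field; rewrite gt_eqF.
have dF1' (x : R) : 0 < x < 1 -> is_derive x 1 F1
    (k * (w * (- sin (w * x) * (P x - 1) + cos (w * x) * Q x) + F x)).
  move=> x01; have := dP _ x01; have := dQ _ x01 => D1 D2.
  have D : is_derive x 1 (fun x => k * (cos (w * x) * (P x - 1) + sin (w * x) * Q x))
      (k * (w * (- sin (w * x) * (P x - 1) + cos (w * x) * Q x) + F x)).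
    auto_is_derive.
    have E : F x = F x * (cos (w * x) ^+ 2 + sin (w * x) ^+ 2).
      by rewrite cos2Dsin2 mulr1.
    rewrite [in RHS]E; ring.
  apply: near_eq_is_derive D.
  have xI : x \in `]0, 1[ by rewrite in_itv.
  have := near_in_itvoo xI; apply: filterS => z; rewrite in_itv /= => /andP[z0 z1].
  by rewrite F1E // !ltW.
(* A first integral: its derivative is - w F1 + w F1, and it vanishes at 0. It expresses the
   remaining combination of [P] and [Q] through F. *)
have SE : forall x, 0 <= x <= 1 ->
    k * (- sin (w * x) * (P x - 1) + cos (w * x) * Q x) + w * F x = 0.
  move=> x x01.
  rewrite (@is_derive_0_cst R (fun x => k * (- sin (w * x) * (P x - 1)
     + cos (w * x) * Q x) + w * F x) 0 1 _ _ x x01).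
  - by rewrite mulr0 sin0 P0 Q0 /F h00; ring.
  - move=> s; apply: cvgD; last first.
      by apply: cvgM; [exact: cvg_cst | exact: cF].
    apply: cvgM; first exact: cvg_cst.
    apply: cvgD; apply: cvgM.
    + by apply: cvgN; exact: (continuous_subspaceT sin_c).
    + by apply: cvgB; [exact: cP | exact: cvg_cst].
    + exact: (continuous_subspaceT cos_c).
    + exact: cQ.
  - move=> z z01; have := dP _ z01; have := dQ _ z01; have := dF _ z01 => D0 D1 D2.
    auto_is_derive; rewrite F1E; last by case/andP: z01 => z0 z1; rewrite !ltW.
    ring.
have dF1 (x : R) : 0 < x < 1 -> is_derive x 1 F1 (mu ^+ 2 * F x).
  move=> x01; apply: (is_derive_eq (dF1' _ x01)).
  have := SE x; case/andP: x01 => x0 x1; rewrite !ltW // => /(_ isT).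
  set T := - sin _ * _ + _ => H.
  have -> : k * (w * T + F x) = w * (k * T) + k * F x by ring.
  have -> : k * T = - (w * F x) by lra.
  rewrite mulrN mulrA -expr2 w2 mu2 /k; field.
  by rewrite gt_eqF.
have F00 : F 0 = 0 by [].
have F10 : F1 0 = - k.
  by rewrite F1E ?lexx ?ler01 // P0 Q0 mulr0 cos0; ring.
have H y : 0 < y < 1 -> h 1 y = kerF k mu (1 - y) /\ hx 1 y = kerF' k mu (1 - y).
  move=> /andP[y0 y1].
  have [-> ->] := kernel_diff _ _ _ _ _ _ _ Ch Chx Chy wave diag 1 y (ltW y0) y1 (lexx 1).
  apply: (kerF_unique _ F F1) => //; first by rewrite gt_eqF.
  by apply/andP; split; lra.
have T (y : R) : `[0, 1]%classic y -> triangle (1 : R, y).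
  by rewrite /= in_itv /= => /andP[y0 y1]; split.
have mu1 : mu != 0 by rewrite gt_eqF.
move=> y yI; split.
- apply: (within_continuous_eq _ (h 1) (fun y => kerF k mu (1 - y)) 0 1) => //.
  + by case: Ch => c _ _ _; apply: (within_continuous_slice2 _ _ _ _ _ c).
  + apply: continuous_subspaceT => z; have D := is_derive_kerF _ k mu (1 - z) mu1.
    exact: is_derive_continuous (is_derive_onem _ _ _ _ D).
  + by move=> z /H[].
- apply: (within_continuous_eq _ (hx 1) (fun y => kerF' k mu (1 - y)) 0 1) => //.
  + by case: Chx => c _ _ _; apply: (within_continuous_slice2 _ _ _ _ _ c).
  + apply: continuous_subspaceT => z; have D := is_derive_kerF' _ k mu (1 - z) mu1.
    exact: is_derive_continuous (is_derive_onem _ _ _ _ D).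
  + by move=> z /H[].
Qed.

(** * Uniform smoothness of the gains *)

Section uniformly_smooth.
Context {R : realType} {T : Type}.
Variable A : set T.
Implicit Types (f g : T -> R -> R) (n : nat).

Definition bounded_on (g : T -> R) := exists M, forall i, A i -> `|g i| <= M.

Definition ubounded f :=
  exists M, forall i x, A i -> 0 <= x <= 1 -> `|f i x| <= M.

(** Bounds up to order n are independent of the parameter, while continuity of the last derivative
    is asked parameter by parameter. Derivatives are two-sided even at 0 and 1, which suits formulas
    that make sense on both sides of the end points. *)
Fixpoint usmooth n f : Prop :=
  ubounded f /\
  match n with
  | 0%N => forall i, A i -> {within `[0, 1], continuous (f i)}
  | n'.+1 => exists2 f' : T -> R -> R,
      forall i (x : R), A i -> 0 <= x <= 1 -> is_derive x 1 (f i) (f' i x)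
      & usmooth n' f'
  end.

Lemma usmooth_pred n f : usmooth n.+1 f -> usmooth n f.
Proof.
elim: n f => [|n IHn] f [bf [f' df sf']]; split => //.
- move=> i Ai; apply: derivable_within_continuous => x; rewrite in_itv /= => xI.
  exact: is_derive_derivable (df i x Ai xI).
- by exists f' => //; exact: IHn.
Qed.

Lemma usmooth_cst n (g : T -> R) : bounded_on g -> usmooth n (fun i _ => g i).
Proof.
elim: n g => [|n IHn] g [M gM]; split; try by exists M => i x Ai _; exact: gM.
- by move=> i _; apply: continuous_subspaceT => x; exact: cvg_cst.
- exists (fun _ _ => 0) => [i x _ _|]; first exact: is_derive_cst.
  by apply: (IHn (fun=> 0)); exists 0 => i _; rewrite normr0.
Qed.

Lemma usmooth_id n : usmooth n (fun _ x => x).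
Proof.
have B : ubounded (fun _ x => x).
  by exists 1 => i x _ /andP[x0 x1]; rewrite ger0_norm.
case: n => [|n]; split => //.
  by move=> i _; apply: continuous_subspaceT => x; exact: cvg_id.
exists (fun _ _ => 1) => [i x _ _|]; first exact: is_derive_id.
by apply: (usmooth_cst n (fun=> 1)); exists 1 => i _; rewrite normr1.
Qed.

Lemma usmoothD n f g : usmooth n f -> usmooth n g ->
  usmooth n (fun i x => f i x + g i x).
Proof.
have B f' g' : ubounded f' -> ubounded g' -> ubounded (fun i x => f' i x + g' i x).
  move=> [M HM] [N HN]; exists (M + N) => i x Ai xI.
  by apply: le_trans (ler_normD _ _) _; rewrite lerD ?HM ?HN.
elim: n f g => [|n IHn] f g [bf cf] [bg cg]; split; try exact: B.
- by move=> i Ai x; apply: cvgD; [exact: cf | exact: cg].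
- have [f' df sf] := cf; have [g' dg sg] := cg.
  exists (fun i x => f' i x + g' i x); last exact: IHn.
  by move=> i x Ai xI; apply: is_deriveD; [exact: df | exact: dg].
Qed.

Lemma usmoothM n f g : usmooth n f -> usmooth n g ->
  usmooth n (fun i x => f i x * g i x).
Proof.
have B f' g' : ubounded f' -> ubounded g' -> ubounded (fun i x => f' i x * g' i x).
  move=> [M HM] [N HN]; exists (M * N) => i x Ai xI.
  by rewrite normrM ler_pM ?HM ?HN.
elim: n f g => [|n IHn] f g sf sg.
  case: sf sg => [bf cf] [bg cg]; split; first exact: B.
  by move=> i Ai x; apply: cvgM; [exact: cf | exact: cg].
have := usmooth_pred _ _ sf; have := usmooth_pred _ _ sg => sg1 sf1.
case: sf sg => [bf [f' df sf']] [bg [g' dg sg']]; split; first exact: B.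
exists (fun i x => f i x * g' i x + g i x * f' i x).
  move=> i x Ai xI; have Df := df i x Ai xI; have Dg := dg i x Ai xI.
  by auto_is_derive.
by apply: usmoothD; apply: IHn.
Qed.

Lemma usmoothN n f : usmooth n f -> usmooth n (fun i x => - f i x).
Proof.
move=> sf; have := usmoothM n (fun _ _ => -1) f.
rewrite (_ : (fun i x => -1 * f i x) = (fun i x => - f i x)); last first.
  by apply/funext => i; apply/funext => x; rewrite mulN1r.
by apply => //; apply: (usmooth_cst n (fun=> -1)); exists 1 => i _; rewrite normrN1.
Qed.

(** The last premise is vacuous for n = 0, so that base and step of an induction on n can share one
    computation of the derivative. *)
Lemma usmooth_rec n f (f' : T -> R -> R) : ubounded f ->
  (forall i (x : R), A i -> 0 <= x <= 1 -> is_derive x 1 (f i) (f' i x)) ->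
  (forall m, n = m.+1 -> usmooth m f') -> usmooth n f.
Proof.
move=> bf df sf'; case: n sf' => [|n] sf'; split => //.
- move=> i Ai; apply: derivable_within_continuous => x; rewrite in_itv /= => xI.
  exact: is_derive_derivable (df i x Ai xI).
- by exists f' => //; exact: sf'.
Qed.

(** * The pieces of the gain, for c = lambda/eps, mu = sqrt(a/eps), r = q - lambda/(2 eps) *)

Section kernel_pieces.
Variables (k m0 : R) (c mu r : T -> R).
Hypotheses (m0_gt0 : 0 < m0) (mu_ge : forall i, A i -> m0 <= mu i).
Hypotheses (bc : bounded_on c) (bmu : bounded_on mu) (br : bounded_on r).

Let mu_neq0 i : A i -> mu i != 0.
Proof. by move=> Ai; rewrite gt_eqF // (lt_le_trans m0_gt0) ?mu_ge. Qed.

(** The range |s| <= 2 is that of 1 - z for z in [-1, 1], where the extended Volterra integrals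
    live. The lower bound [m0] controls the division by mu. *)
Lemma kerF_bounded : exists2 M, 0 <= M & forall i s, A i -> `|s| <= 2 ->
  `|kerF k (mu i) s| <= M /\ `|kerF' k (mu i) s| <= M.
Proof.
have [N HN] := bmu.
have N0 i : A i -> 0 <= N by move=> Ai; exact: le_trans (normr_ge0 _) (HN i Ai).
exists (`|k| / m0 * expR (2 * N) + `|k| * expR (2 * N)).
  by rewrite addr_ge0 // mulr_ge0 ?expR_ge0 ?divr_ge0 ?normr_ge0 // ltW.
move=> i s Ai s2.
have ms : `|mu i * s| <= 2 * N.
  by rewrite normrM mulrC ler_pM // HN.
have e1 : expR (mu i * s) <= expR (2 * N).
  by rewrite ler_expR (le_trans (ler_norm _)).
have e2 : expR (- (mu i * s)) <= expR (2 * N).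
  by rewrite ler_expR (le_trans (ler_norm _)) // normrN.
have p1 := expR_gt0 (mu i * s); have p2 := expR_gt0 (- (mu i * s)).
have E0 := expR_ge0 (2 * N).
have m1 := mu_ge _ Ai; have mp : 0 < mu i by rewrite (lt_le_trans m0_gt0).
split.
  rewrite /kerF normrM; apply: (@le_trans _ _ (`|k| / m0 * expR (2 * N))); last first.
    by rewrite lerDl mulr_ge0.
  rewrite (_ : - k / (2 * mu i) = (- k / mu i) / 2); last by field; exact: mu_neq0.
  rewrite normrM -mulrA; apply: ler_pM => //.
  - rewrite normrM normrN normfV (gtr0_norm mp); apply: ler_wpM2l => //.
    by rewrite lef_pV2.
  - rewrite normfV (ger0_norm (_ : 0 <= 2)) // mulrC ler_pdivrMr //.
    by rewrite ler_norml; apply/andP; split; lra.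
rewrite /kerF' normrM; apply: (@le_trans _ _ (`|k| * expR (2 * N))); last first.
  by rewrite lerDr mulr_ge0 // divr_ge0 // ltW.
rewrite normrM normrN -mulrA; apply: ler_wpM2l => //.
rewrite normfV (ger0_norm (_ : 0 <= 2)) // mulrC ler_pdivrMr //.
by rewrite ler_norml; apply/andP; split; lra.
Qed.

(** Up to the bounded factor mu^2 and a sign, differentiation exchanges the two functions, so they
    are treated in one induction. *)
Lemma usmooth_kerF n :
  usmooth n (fun i x => kerF k (mu i) (1 - x)) /\
  usmooth n (fun i x => kerF' k (mu i) (1 - x)).
Proof.
have [M M0 HM] := kerF_bounded.
have N1 (x : R) : 0 <= x <= 1 -> `|1 - x| <= 2.
  by move=> /andP[x0 x1]; rewrite ler_norml; apply/andP; split; lra.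
have bmu2 : bounded_on (fun i => mu i ^+ 2).
  have [N HN] := bmu; exists (N ^+ 2) => i Ai.
  by rewrite normrX ler_sqr ?nnegrE ?HN // (le_trans _ (HN _ Ai)).
have [b1 b2] : ubounded (fun i x => kerF k (mu i) (1 - x)) /\
    ubounded (fun i x => kerF' k (mu i) (1 - x)).
  by split; exists M => i x Ai xI; have [] := HM _ _ Ai (N1 _ xI).
elim: n => [|n [IH1 IH2]]; split.
- apply: (usmooth_rec _ _ (fun i x => - kerF' k (mu i) (1 - x))) => // i x Ai xI.
  by have D := is_derive_kerF _ k _ (1 - x) (mu_neq0 _ Ai); exact: is_derive_onem.
- apply: (usmooth_rec _ _ (fun i x => - (mu i ^+ 2 * kerF k (mu i) (1 - x)))) => // i x Ai xI.
  by have D := is_derive_kerF' _ k _ (1 - x) (mu_neq0 _ Ai); exact: is_derive_onem.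
- apply: (usmooth_rec _ _ (fun i x => - kerF' k (mu i) (1 - x))) => // [i x Ai xI|m [<-]].
  by have D := is_derive_kerF _ k _ (1 - x) (mu_neq0 _ Ai); exact: is_derive_onem.
  exact: usmoothN.
- apply: (usmooth_rec _ _ (fun i x => - (mu i ^+ 2 * kerF k (mu i) (1 - x)))) => // [i x Ai xI|m [<-]].
  by have D := is_derive_kerF' _ k _ (1 - x) (mu_neq0 _ Ai); exact: is_derive_onem.
  by apply: usmoothN; apply: usmoothM => //; exact: usmooth_cst.
Qed.

Lemma besselD_bounded j : exists2 M, 0 <= M & forall i (x y : R), A i ->
  -1 <= x <= 1 -> -1 <= y <= 1 -> `|besselD j (c i * (x ^+ 2 - y ^+ 2))| <= M.
Proof.
have [N HN] := bc; exists (expR N); first exact: expR_ge0.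
move=> i x y Ai /andP[x0 x1] /andP[y0 y1].
apply: le_trans (normr_besselD_le _ _) _; rewrite ler_expR normrM.
have xy : `|x ^+ 2 - y ^+ 2| <= 1.
  by rewrite ler_norml; apply/andP; split; nra.
have := HN i Ai; have := normr_ge0 (c i); have := normr_ge0 (x ^+ 2 - y ^+ 2).
nra.
Qed.

Lemma is_derive_besselD_sqr j i (z y : R) :
  is_derive y 1 (fun y => besselD j (c i * (z ^+ 2 - y ^+ 2)))
    (-2 * c i * y * besselD j.+1 (c i * (z ^+ 2 - y ^+ 2))).
Proof.
have D1 : is_derive y 1 (fun y => c i * (z ^+ 2 - y ^+ 2)) (-2 * c i * y).
  by auto_is_derive; ring.
have D := is_derive_besselD j (c i * (z ^+ 2 - y ^+ 2)).
have := @is_derive1_comp R (besselD j) (fun y => c i * (z ^+ 2 - y ^+ 2)) y _ _ D D1.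
by rewrite mulrC.
Qed.

Lemma usmooth_besselD n j :
  usmooth n (fun i y => besselD j (c i * (1 - y ^+ 2))).
Proof.
elim: n j => [|n IHn] j;
  apply: (usmooth_rec _ _
    (fun i y => -2 * c i * y * besselD j.+1 (c i * (1 - y ^+ 2)))).
1,4: have [M M0 HM] := besselD_bounded j; exists M => i y Ai /andP[y0 y1].
1,2: have := HM i 1 y Ai; rewrite expr1n; apply;
  by apply/andP; split; lra.
1,3: by move=> i y _ _; have := is_derive_besselD_sqr j i 1 y; rewrite expr1n.
  by [].
move=> m [<-]; apply: usmoothM => //; apply: usmoothM; last exact: usmooth_id.
apply: (usmooth_cst n (fun i => -2 * c i)); have [M HM] := bc.
by exists (`|-2| * M) => i Ai; rewrite normrM ler_wpM2l ?HM.
Qed.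

(** The factor h_x(1,z) + r h(1,z) common to [K1] and [K2], with the kernel in closed form. *)
Definition kerphi i (z : R) := kerF' k (mu i) (1 - z) + r i * kerF k (mu i) (1 - z).

(** For j = 0 this is, up to the factor - c, the integrand of the last term of [K1]; larger j arise
    by differentiating in y. *)
Definition volterra_integrand j i (z y : R) :=
  kerphi i z * z * besselD j (c i * (z ^+ 2 - y ^+ 2)).

(* [\int_y^1], written so that it is differentiable in y at y = 1 as well. *)
Definition volterra j i (y : R) : R :=
  \int[@lebesgue_measure R]_(z in `[-1, 1]) volterra_integrand j i z y
  - \int[@lebesgue_measure R]_(z in `[-1, y]) volterra_integrand j i z y.

Lemma continuous_kerphi i : A i -> continuous (kerphi i).
Proof.
move=> Ai z.
have D2 := is_derive_kerF _ k _ (1 - z) (mu_neq0 _ Ai).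
have D3 := is_derive_kerF' _ k _ (1 - z) (mu_neq0 _ Ai).
have C1 := is_derive_continuous _ _ _ _ (is_derive_onem _ _ _ _ D2).
have C2 := is_derive_continuous _ _ _ _ (is_derive_onem _ _ _ _ D3).
by apply: cvgD; [exact: C2 | apply: cvgM; [exact: cvg_cst | exact: C1]].
Qed.

Lemma continuous_volterra_integrand j i : A i ->
  continuous (fun p : R * R => volterra_integrand j i p.1 p.2).
Proof.
move=> Ai p; apply: cvgM.
  apply: cvgM; last exact: cvg_fst.
  apply: (@continuous_comp _ _ _ fst (kerphi i)); first exact: cvg_fst.
  exact: continuous_kerphi.
apply: (@continuous_comp _ _ _ (fun p : R * R => c i * (p.1 ^+ 2 - p.2 ^+ 2)) (besselD j)).
  apply: cvgM; first exact: cvg_cst.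
  apply: cvgB; rewrite !expr2; apply: cvgM; solve [exact: cvg_fst | exact: cvg_snd].
exact: is_derive_continuous (is_derive_besselD _ _).
Qed.

Lemma is_derive_volterra_integrand j i (z y : R) :
  is_derive y 1 (volterra_integrand j i z)
    (-2 * c i * y * volterra_integrand j.+1 i z y).
Proof.
have D := is_derive_besselD_sqr j i z y.
have D2 := @is_deriveZ R R R _ (kerphi i z * z) y 1 _ D.
apply: (is_derive_eq D2); rewrite /GRing.scale /= /volterra_integrand; ring.
Qed.

Lemma volterra_integrand_bounded j : exists2 M, 0 <= M & forall i (x y : R), A i ->
  -1 <= x <= 1 -> -1 <= y <= 1 -> `|volterra_integrand j i x y| <= M.
Proof.
have [M1 M10 HM1] := besselD_bounded j; have [M2 M20 HM2] := kerF_bounded.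
have [M3 HM3] := br.
exists ((M2 + `|M3| * M2) * 1 * M1); first by rewrite !mulr_ge0 // addr_ge0 // mulr_ge0.
move=> i x y Ai xI yI; have [x0 x1] := andP xI.
have [|K1 K2] := HM2 i (1 - x) Ai; first by rewrite ler_norml; apply/andP; split; lra.
have Hphi : `|kerphi i x| <= M2 + `|M3| * M2.
  apply: le_trans (ler_normD _ _) _; apply: lerD => //.
  by rewrite normrM; apply: ler_pM => //; rewrite (le_trans (HM3 _ Ai)) // ler_norm.
have Hx : `|x| <= 1 by rewrite ler_norml x0.
rewrite /volterra_integrand normrM; apply: ler_pM => //; last exact: HM1.
by rewrite normrM; apply: ler_pM.
Qed.

Lemma integrable_volterra j i (a b y : R) : A i ->
  (@lebesgue_measure R).-integrable `[a, b] (EFin \o (fun z => volterra_integrand j i z y)).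
Proof.
move=> Ai; apply: continuous_compact_integrable; first exact: segment_compact.
apply: (within_continuous_slice1 _ setT) => //.
by apply: continuous_subspaceT; exact: continuous_volterra_integrand.
Qed.

Lemma is_derive_volterra j i (y : R) : A i -> 0 <= y <= 1 ->
  is_derive y 1 (volterra j i)
    (-2 * c i * y * volterra j.+1 i y - kerphi i y * y * besselD j 0).
Proof.
move=> Ai /andP[y0 y1].
pose f2 z y := -2 * c i * y * volterra_integrand j.+1 i z y.
have cf2 : continuous (fun p : R * R => f2 p.1 p.2).
  move=> p; apply: cvgM; last exact: continuous_volterra_integrand.
  by apply: cvgM; [exact: cvg_cst | exact: cvg_snd].
have D1 : is_derive y 1 (fun y => \int[@lebesgue_measure R]_(z in `[-1, y]) volterra_integrand j i z y)
    (volterra_integrand j i y y + \int[@lebesgue_measure R]_(z in `[-1, y]) f2 z y).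
  (* The lower limit -1 lies strictly to the left of y, also when y = 0. *)
  apply: (@Leibniz_integral R (volterra_integrand j i) f2 (-1) y); first lra.
  - exact: continuous_volterra_integrand.
  - exact: cf2.
  - by move=> *; exact: is_derive_volterra_integrand.
have D2 : is_derive y 1 (fun y => \int[@lebesgue_measure R]_(z in `[-1, 1]) volterra_integrand j i z y)
    (\int[@lebesgue_measure R]_(z in `[-1, 1]) f2 z y).
  have [|M M0 HM] := @continuous_rectangle_bounded R f2 (-1) 1 (y - 1) (y + 1).
    exact: continuous_subspaceT.
  apply: (@is_derive_under_integral R (volterra_integrand j i) f2 (-1) 1 y 1 M).
  + exact: ltr01.
  + by move=> t _; exact: integrable_volterra.
  + by move=> *; exact: is_derive_volterra_integrand.
  + by move=> x t /andP[ax xy] /andP[t1 t2]; apply: HM; rewrite !ltW.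
  + apply: (within_continuous_slice1 _ setT) => //.
    exact: continuous_subspaceT.
apply: (is_derive_eq (is_deriveB D2 D1)).
have E a b : \int[@lebesgue_measure R]_(z in `[a, b]) f2 z y
  = -2 * c i * y * \int[@lebesgue_measure R]_(z in `[a, b]) volterra_integrand j.+1 i z y.
  by rewrite /f2 RintegralZl //; exact: integrable_volterra.
have V0 : volterra_integrand j i y y = kerphi i y * y * besselD j 0.
  by rewrite /volterra_integrand subrr mulr0.
rewrite !E V0 /volterra; ring.
Qed.

Lemma volterraE j i (y : R) : A i -> 0 <= y <= 1 ->
  volterra j i y = \int[@lebesgue_measure R]_(z in `[y, 1]) volterra_integrand j i z y.
Proof.
move=> Ai /andP[y0 y1]; rewrite /volterra Rintegral_itvB.
- rewrite Rintegral_itv_obnd_cbnd //.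
  apply: integrableS (integrable_volterra j i y 1 y Ai) => //.
  exact: subset_itv_oc_cc.
- exact: integrable_volterra.
- by rewrite bnd_simp; lra.
- by rewrite bnd_simp.
Qed.

Lemma volterra_ubounded j : ubounded (volterra j).
Proof.
have [M M0 HM] := volterra_integrand_bounded j; exists M => i y Ai yI.
have [y0 y1] := andP yI.
rewrite volterraE //; apply: (@le_trans _ _ (M * (1 - y))); last first.
  by rewrite ler_piMr //; lra.
apply: normr_integral_le => //; first exact: integrable_volterra.
by move=> x /andP[yx x1]; apply: HM => //; apply/andP; split; lra.
Qed.

(** One derivative in y costs one more derivative of the Bessel factor and a boundary term that is
    already smooth, so the induction on n runs over all j at once. *)
Lemma usmooth_volterra n j : usmooth n (volterra j).
Proof.
elim: n j => [|n IHn] j; apply: (usmooth_rec _ _ (fun i y =>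
  -2 * c i * y * volterra j.+1 i y - kerphi i y * y * besselD j 0)) => //.
- exact: volterra_ubounded.
- by move=> i x; exact: is_derive_volterra.
- exact: volterra_ubounded.
- by move=> i x; exact: is_derive_volterra.
move=> m [<-]; have [sF sF'] := usmooth_kerF n.
apply: usmoothD.
  apply: usmoothM => //; apply: usmoothM; last exact: usmooth_id.
  apply: (usmooth_cst n (fun i => -2 * c i)); have [M HM] := bc.
  by exists (`|-2| * M) => i Ai; rewrite normrM ler_wpM2l ?HM.
apply: usmoothN; apply: usmoothM; last first.
  by apply: (usmooth_cst n (fun=> besselD j 0)); exists `|besselD j 0|.
apply: usmoothM; last exact: usmooth_id.
apply: usmoothD => //; apply: usmoothM => //; exact: usmooth_cst.
Qed.

(** Equal to [K1] on [0,1) only: at y = 1 the derivative in [Psix1] is a junk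
    value. *)
Definition gain i (y : R) : R :=
  - c i * (besselD 0 (c i * (1 - y ^+ 2)) + 2 * c i * besselD 1 (c i * (1 - y ^+ 2)))
  + kerphi i y + - (r i * c i) * besselD 0 (c i * (1 - y ^+ 2))
  + c i * volterra 0 i y.

Lemma usmooth_gain n : usmooth n gain.
Proof.
have [sF sF'] := usmooth_kerF n.
have [M HM] := bc; have [N HN] := br.
have sc : usmooth n (fun i _ => c i) by exact: usmooth_cst.
have sr : usmooth n (fun i _ => r i) by exact: usmooth_cst.
have s2 : usmooth n (fun _ _ => 2).
  by apply: (usmooth_cst n (fun=> 2)); exists `|2|.
have sb j := usmooth_besselD n j.
apply: usmoothD; last by apply: usmoothM => //; exact: usmooth_volterra.
apply: usmoothD; last by apply: usmoothM => //; apply: usmoothN; exact: usmoothM.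
apply: usmoothD; last by apply: usmoothD => //; exact: usmoothM.
apply: usmoothM; first exact: usmoothN.
by apply: usmoothD => //; apply: usmoothM => //; exact: usmoothM.
Qed.

End kernel_pieces.
End uniformly_smooth.

(** * Dynamics of the deviation *)

Lemma normr_lt_sqr (R : realFieldType) (x r : R) :
  0 < r -> x ^+ 2 < r ^+ 2 -> `|x| < r.
Proof. by move=> r0 xr; rewrite ltr_norml; apply/andP; split; nra. Qed.

Lemma interior_strip (R : realType) (s e y t : R) : 0 < y < 1 -> s < t < e ->
  interior [set p : R * R | 0 <= p.1 <= 1 /\ s < p.2 < e] (y, t).
Proof.
move=> /andP[y0 y1] /andP[st te].
have r0 : 0 < Num.min (Num.min y (1 - y)) (Num.min (t - s) (e - t)).
  by rewrite !lt_min !subr_gt0 y0 y1 st te.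
apply/nbhs_ballP; exists (Num.min (Num.min y (1 - y)) (Num.min (t - s) (e - t))) => //=.
move=> -[y' t'] [/=]; rewrite /ball /= !lt_min !ltr_norml.
move=> /andP[/andP[/andP[? ?] /andP[? ?]] _].
move=> /andP[_ /andP[/andP[? ?] /andP[? ?]]].
by split; apply/andP; split; lra.
Qed.

Section plant_moments.
Context {R : realType}.
Variables (eps b q lam a : R) (s e Ud : R) (v : R -> R -> R) (z : R -> R).
Hypothesis eps_ge0 : 0 <= eps.
Hypothesis plant : plant_solution eps b q (lam, a) Ud s e v z.
Variables (K K' K'' : R -> R) (k2 M : R).
Hypothesis M_gt0 : 0 < M.
Hypothesis dK : forall y : R, 0 <= y <= 1 -> is_derive y 1 K (K' y).
Hypothesis dK' : forall y : R, 0 <= y <= 1 -> is_derive y 1 K' (K'' y).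
Hypothesis cK'' : {within `[0, 1], continuous K''}.
Hypothesis bK : forall y, 0 <= y <= 1 -> `|K y| <= M.
Hypothesis bK' : forall y, 0 <= y <= 1 -> `|K' y| <= M.
Hypothesis bK'' : forall y, 0 <= y <= 1 -> `|K'' y| <= M.

Let moment (t : R) := \int[@lebesgue_measure R]_(y in `[0, 1]) (K y * v y t).

Let cK : {within `[0, 1], continuous K}.
Proof.
apply: derivable_within_continuous => y; rewrite in_itv /= => yI.
exact: is_derive_derivable (dK _ yI).
Qed.

Let cK' : {within `[0, 1], continuous K'}.
Proof.
apply: derivable_within_continuous => y; rewrite in_itv /= => yI.
exact: is_derive_derivable (dK' _ yI).
Qed.

Lemma plant_L2 t : s <= t <= e -> L2_01 (v ^~ t).
Proof. by case: plant => ux [ut [uxx [C _ _ _ _]]] /C[]. Qed.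

Lemma L2_01B (f g : R -> R) : L2_01 f -> L2_01 g -> L2_01 (fun x => f x - g x).
Proof.
move=> [mf jf] [mg jg].
have mfg : measurable_fun (`[(0 : R), 1]%classic : set R) (fun x => f x - g x : R).
  exact: measurable_funB.
split => //.
have jf2 : (@lebesgue_measure R).-integrable `[0, 1] (fun x => (2 * f x ^+ 2)%:E).
  rewrite (_ : (fun x => _) = fun x => (2%:E * (f x ^+ 2)%:E)%E) //.
  exact: integrableZl.
have jg2 : (@lebesgue_measure R).-integrable `[0, 1] (fun x => (2 * g x ^+ 2)%:E).
  rewrite (_ : (fun x => _) = fun x => (2%:E * (g x ^+ 2)%:E)%E) //.
  exact: integrableZl.
have j := integrableD _ jf2 jg2; apply: le_integrable (j _) => //.
- by apply/measurable_EFinP; exact: measurable_funX.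
- move=> x _; rewrite -EFinD /= lee_fin ger0_norm ?sqr_ge0 // ger0_norm.
    by have := sqr_ge0 (f x + g x); nra.
  by rewrite addr_ge0 // mulr_ge0 // sqr_ge0.
Qed.

(** Pairing with the bounded weight [K] turns continuity in L^2, which is all that holds at the two
    ends, into continuity of a scalar. *)
Lemma moment_within_continuous : {within `[s, e], continuous moment}.
Proof.
case: plant => ux [ut [uxx [C _ _ _ _]]].
apply/subspace_continuousP => t; rewrite /= in_itv /= => tI.
have [L2t Ct] := C t tI.
apply/cvgrPdist_lt => r r0.
have r1 : 0 < (r / M) ^+ 2 by rewrite exprn_gt0 // divr_gt0.
have /cvgrPdist_lt /(_ _ r1) H := Ct.
near=> t'.
have t'I : s <= t' <= e.
  have : t' \in `[s, e] by near: t'; exact: withinT.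
  by rewrite in_itv.
have : `|0 - L2norm_sq (fun x => v x t' - v x t)| < (r / M) ^+ 2 by near: t'; exact: H.
rewrite sub0r normrN => /(le_lt_trans (ler_norm _)) L.
have [L2t' _] := C t' t'I.
have := sqr_integralM_le _ K _ M M_gt0 cK bK (L2_01B _ _ L2t' L2t).
have -> : \int[@lebesgue_measure R]_(x in `[0, 1]) (K x * (v x t' - v x t))
    = moment t' - moment t.
  rewrite /moment -RintegralB //; try exact: L2_01_integrableM.
  by apply: eq_Rintegral => x _; rewrite mulrBr.
move=> H1; have {H1} : (moment t' - moment t) ^+ 2 < r ^+ 2.
  apply: le_lt_trans H1 _.
  by rewrite mulrC -ltr_pdivlMr ?exprn_gt0 // -expr_div_n.
by rewrite distrC; exact: normr_lt_sqr.
Unshelve. all: by end_near. Qed.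

Lemma ode_within_continuous : {within `[s, e], continuous z}.
Proof.
case: plant => ux [ut [uxx [_ _ _ _ [iz zE]]]].
have [se|es] := leP s e; last first.
  rewrite (_ : [set` _] = set0); first exact: continuous_subspace0.
  by apply/seteqP; split => x //=; rewrite in_itv /= => /andP[? ?]; lra.
have cI := parameterized_integral_continuous se iz.
apply/subspace_continuousP => t tI; move: (tI); rewrite /= in_itv /= => tI'.
move/subspace_continuousP : cI => /(_ t tI) cI.
have H : (fun t => z s + \int[@lebesgue_measure R]_(tau in `[s, t]) (a * z tau + b * v 0 tau))
   @ within `[s, e] (nbhs t) --> z s + \int[@lebesgue_measure R]_(tau in `[s, t]) (a * z tau + b * v 0 tau).
  by apply: cvgD; [exact: cvg_cst | exact: cI].
rewrite [X in _ --> X]zE //; apply: cvg_trans H; apply: near_eq_cvg.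
near=> t'; rewrite [RHS]zE //.
have : t' \in `[s, e] by near: t'; exact: withinT.
by rewrite in_itv.
Unshelve. all: by end_near. Qed.

Lemma is_derive_ode (t : R) : s < t < e -> is_derive t 1 z (a * z t + b * v 0 t).
Proof.
move=> tI; case: plant => ux [ut [uxx [_ [cv _ _ _] _ _ [iz zE]]]].
have se : s < e by case/andP: tI => ? ?; lra.
have ct : {for t, continuous z}.
  by apply: (within_continuous_continuous se ode_within_continuous); rewrite in_itv.
have cv0 : {for t, continuous (v 0)}.
  have H : {in `]s, e[%classic, continuous (v 0)}.
    rewrite -continuous_open_subspace; last exact: itv_open.
    apply: (within_continuous_slice2 _ _ _ _ _ cv) => x /=.
    by rewrite in_itv /= => xI; rewrite lexx ler01.
  by apply: H; rewrite inE /= in_itv.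
have cf : {for t, continuous (fun tau => a * z tau + b * v 0 tau)}.
  by apply: cvgD; apply: cvgM; solve [exact: cvg_cst | exact: ct | exact: cv0].
have D1 := @is_derive_integral R (fun tau => a * z tau + b * v 0 tau) s t e tI iz cf.
have D2 : is_derive t 1 (cst (z s) : R -> R) 0 by exact: is_derive_cst.
have D := is_deriveD D2 D1; rewrite add0r in D.
apply: near_eq_is_derive D; have tI' : t \in `]s, e[ by rewrite in_itv.
have := near_in_itvoo tI'; apply: filterS => t'; rewrite in_itv /= => /andP[t1 t2].
by rewrite [RHS]zE // !ltW.
Qed.

(** The result of integrating twice by parts, with u_x(1) replaced by Ud - q u(1) and u_x(0) by 0:
    only traces and an integral of [w] remain. *)
Definition moment_rate (v1 v0 : R) (w : R -> R) :=
  eps * (K 1 * (Ud - q * v1) - K' 1 * v1 + K' 0 * v0)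
  + \int[@lebesgue_measure R]_(y in `[0, 1]) ((eps * K'' y + lam * K y) * w y).

(* Green's identity: [K v_x - K' v] is a primitive of [K v_xx - K'' v]. *)
Lemma is_derive_moment (t : R) : s < t < e ->
  is_derive t 1 moment (moment_rate (v 1 t) (v 0 t) (v ^~ t)).
Proof.
move=> tI; case: plant => ux [ut [uxx [C [cv cux cut dv] cx pde _]]].
have [t1 t2] := andP tI.
(* Half the distance to the ends keeps a compact time window inside the open interval; on it [ut] is
   bounded, which gives the majorant for differentiating under the integral. *)
pose r := Num.min (t - s) (e - t) / 2.
have rts : r < t - s.
  rewrite /r; have : Num.min (t - s) (e - t) <= t - s by rewrite ge_min lexx.
  by lra.
have ret : r < e - t.
  rewrite /r; have : Num.min (t - s) (e - t) <= e - t by rewrite ge_min lexx orbT.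
  by lra.
have r0 : 0 < r by rewrite divr_gt0 // lt_min !subr_gt0 t1 t2.
have sl (f : R -> R -> R) : {within [set p : R * R | 0 <= p.1 <= 1 /\ s < p.2 < e],
    continuous (fun p : R * R => f p.1 p.2)} -> {within `[0, 1], continuous (f ^~ t)}.
  move=> cf; apply: (within_continuous_slice1 _ _ _ _ _ cf) => x.
  by rewrite /= in_itv.
have [B B0 HB] : exists2 B, 0 < B & forall x t', 0 <= x <= 1 -> t - r <= t' <= t + r ->
    `|ut x t'| <= B.
  apply: continuous_rectangle_bounded; apply: continuous_subspaceW cut.
  by move=> -[x t'] /= [xI /andP[? ?]]; split => //; apply/andP; split; lra.
have ckut : {within `[0, 1], continuous (fun y => K y * ut y t)}.
  by move=> y; apply: cvgM; [exact: cK | exact: (sl _ cut)].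
have D : is_derive t 1 moment (\int[@lebesgue_measure R]_(y in `[0, 1]) (K y * ut y t)).
  apply: (@is_derive_under_integral R (fun y t => K y * v y t)
    (fun y t => K y * ut y t) 0 1 t r (M * B)) => //.
  - move=> t' /andP[? ?]; apply: L2_01_integrableM => //; apply: plant_L2.
    by apply/andP; split; lra.
  - move=> y t' yI /andP[? ?].
    have t'I : s < t' < e by apply/andP; split; lra.
    have [_ D] := dv _ _ (interior_strip _ _ _ _ _ yI t'I).
    have DZ := @is_deriveZ R R R _ (K y) t' 1 _ D; exact: DZ.
  - move=> y t' /andP[y0 y1] /andP[? ?]; rewrite normrM; apply: ler_pM => //.
      by apply: bK; rewrite !ltW.
    by apply: HB; rewrite !ltW.
apply: (is_derive_eq D).
have [pdeE ux0 ux1] := pde t tI; have [cuxt cuxx duxx] := cx t tI.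
have cG : {within `[0, 1], continuous (fun y => K y * uxx y t - K'' y * v y t)}.
  move=> y; apply: cvgB; apply: cvgM.
  - exact: cK.
  - exact: cuxx.
  - exact: cK''.
  - exact: (sl _ cv).
have G : \int[@lebesgue_measure R]_(y in `[0, 1]) (K y * uxx y t - K'' y * v y t)
    = (K 1 * ux 1 t - K' 1 * v 1 t) - (K 0 * ux 0 t - K' 0 * v 0 t).
  apply: (@continuous_FTC2_is_derive R (fun y => K y * uxx y t - K'' y * v y t)
    (fun y => K y * ux y t - K' y * v y t)) => //.
  - move=> y; apply: cvgB; apply: cvgM.
    + exact: cK.
    + exact: cuxt.
    + exact: cK'.
    + exact: (sl _ cv).
  - move=> y yI; have yI' : 0 <= y <= 1 by case/andP: yI => ? ?; rewrite !ltW.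
    have [Dv _] := dv _ _ (interior_strip _ _ _ _ _ yI tI); have Dux := duxx _ yI.
    have DK := dK _ yI'; have DK' := dK' _ yI'.
    by auto_is_derive; ring.
have cL : {within `[0, 1], continuous (fun y => eps * K'' y + lam * K y)}.
  by move=> y; apply: cvgD; apply: cvgM; solve [exact: cvg_cst | exact: cK'' | exact: cK].
have iG : (@lebesgue_measure R).-integrable `[0, 1]
    (EFin \o (fun y => K y * uxx y t - K'' y * v y t)).
  by apply: continuous_compact_integrable => //; exact: segment_compact.
rewrite /moment_rate -ux1 addrK.
transitivity (\int[@lebesgue_measure R]_(y in `[0, 1])
    (eps * (K y * uxx y t - K'' y * v y t) + (eps * K'' y + lam * K y) * v y t)).
  apply: eq_Rintegral => y; rewrite inE /= in_itv /= => yI.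
  by rewrite pdeE //=; ring.
rewrite RintegralD //.
- by rewrite RintegralZl // G ux0; congr (_ + _); ring.
- apply: continuous_compact_integrable; first exact: segment_compact.
  by move=> y; apply: cvgM; [exact: cvg_cst | exact: cG].
- by apply: L2_01_integrableM => //; apply: plant_L2; rewrite !ltW.
Qed.

End plant_moments.

(** * Dwell time from a differential inequality *)

Section dwell_time.
Context {R : realType}.
Variables (xi eta lamd C : R).
Hypotheses (xi0 : 0 < xi) (eta0 : 0 < eta) (lamd0 : 0 < lamd) (C0 : 0 < C).

(** As long as d^2 <= - xi w, one has w' <= - (eta + lamd xi) w, so w exp(g t) with g = eta + lamd
    xi is nonincreasing. *)
Lemma trigger_stays_negative (d w U : R -> R) (s f : R) :
  s <= f -> {within `[s, f], continuous w} -> w s < 0 ->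
  (forall t : R, s < t < f ->
     is_derive t 1 w (- eta * w t + lamd * d t ^+ 2 - U t)) ->
  (forall t, s < t < f -> 0 <= U t) ->
  (forall t, s < t < f -> d t ^+ 2 <= - xi * w t) -> w f < 0.
Proof.
move=> sf cw ws dw U0 dxi; pose g := eta + lamd * xi.
have ce : continuous (fun t => expR (g * t)).
  by move=> t; apply: is_derive_continuous; auto_is_derive; reflexivity.
move: sf; rewrite le_eqVlt => /predU1P[<- //|sf].
have [|||c] := @MVT R (fun t => w t * expR (g * t))
   (fun t => (g * w t - eta * w t + lamd * d t ^+ 2 - U t) * expR (g * t)) s f.
- exact: sf.
- by move=> t; rewrite in_itv /= => tI; have D := dw _ tI; auto_is_derive; ring.
- by move=> t; apply: cvgM; [exact: cw | exact: (continuous_subspaceT ce)].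
rewrite in_itv /= => cI E.
have : w f * expR (g * f) <= w s * expR (g * s).
  rewrite -subr_le0 E; apply: mulr_le0_ge0; last by rewrite subr_ge0 ltW.
  apply: mulr_le0_ge0; last exact: expR_ge0.
  have := dxi _ cI; have := U0 _ cI; rewrite /g => H1 H2.
  have : lamd * d c ^+ 2 <= lamd * (- xi * w c) by rewrite ler_wpM2l // ltW.
  lra.
have : w s * expR (g * s) < 0 by rewrite pmulr_llt0 // expR_gt0.
move=> H1 H2; have := le_lt_trans H2 H1.
by rewrite pmulr_llt0 // expR_gt0.
Qed.

(** Total coefficient of d^2 in the growth of d^2 + sigma w: 2 C / xi and xi / 2 come from Young's
    inequality for 2 d d', and xi lamd from the source term of w' weighted by sigma <= xi. *)
Let beta := 2 * C / xi + xi / 2 + xi * lamd.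
(** The growth that lets slope w outweigh both beta sigma (-w) and eta sigma (-w), taken at the
    largest value sigma = xi. *)
Let slope := beta * xi + eta * xi.

(** Time in which the ramp gains xi / 2; it involves neither the interval nor the initial value of
    w. *)
Definition dwell : R := xi / (2 * slope).

Let beta_gt0 : 0 < beta.
Proof. by rewrite /beta !addr_gt0 ?divr_gt0 ?mulr_gt0. Qed.

Let slope_gt0 : 0 < slope.
Proof. by rewrite /slope addr_gt0 ?mulr_gt0. Qed.

Lemma dwell_gt0 : 0 < dwell.
Proof. by rewrite /dwell divr_gt0 // mulr_gt0. Qed.

Variables (d d' w U : R -> R) (s e : R).
Hypothesis cd : {within `[s, e], continuous d}.
Hypothesis cw : {within `[s, e], continuous w}.
Hypothesis ds : d s = 0.
Hypothesis ws : w s < 0.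
Hypothesis dd : forall t : R, s < t < e -> is_derive t 1 d (d' t).
Hypothesis dw : forall t : R, s < t < e ->
  is_derive t 1 w (- eta * w t + lamd * d t ^+ 2 - U t).
Hypothesis U0 : forall t : R, s < t < e -> 0 <= U t.
Hypothesis d'_le : forall t : R, s < t < e -> d' t ^+ 2 <= C * (d t ^+ 2 + U t).

Let sig (t : R) := xi / 2 + slope * (t - s).

Let sig_le t : t <= s + dwell -> sig t <= xi.
Proof.
move=> td; have : slope * (t - s) <= slope * dwell.
  by apply: ler_wpM2l; [exact: ltW | rewrite lerBlDl].
have -> : slope * dwell = xi / 2.
  by rewrite /dwell; field; rewrite gt_eqF.
rewrite /sig; lra.
Qed.

(* While [w < 0], the function [d^2 + sig w] satisfies g' <= beta g. *)
Lemma deviation_below_ramp (f : R) : s < f -> f <= e -> f <= s + dwell ->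
  (forall t, s <= t < f -> w t < 0) -> d f ^+ 2 + sig f * w f < 0.
Proof.
move=> sf fe fd wneg.
pose P t := (d t ^+ 2 + sig t * w t) * expR (- (beta * t)).
pose P' t := (2 * d t * d' t + slope * w t
   + sig t * (- eta * w t + lamd * d t ^+ 2 - U t)
   - beta * (d t ^+ 2 + sig t * w t)) * expR (- (beta * t)).
have sub : `[s, f] `<=` `[s, e] by apply: subset_itvl; rewrite bnd_simp.
have csig : continuous sig.
  by move=> t; rewrite /sig; apply: is_derive_continuous; auto_is_derive; reflexivity.
have ce : continuous (fun t => expR (- (beta * t))).
  by move=> t; apply: is_derive_continuous; auto_is_derive; reflexivity.
have cd' := continuous_subspaceW sub cd; have cw' := continuous_subspaceW sub cw.
have [|||c] := @MVT R P P' s f.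
- exact: sf.
- move=> t; rewrite in_itv /= => /andP[st tf].
  have tI : s < t < e by rewrite st (lt_le_trans tf).
  have D1 := dd _ tI; have D2 := dw _ tI.
  have D3 : is_derive t 1 sig slope by rewrite /sig; auto_is_derive; ring.
  by rewrite /P /P'; auto_is_derive; ring.
- move=> t; apply: cvgM; last exact: (continuous_subspaceT ce).
  apply: cvgD; last by apply: cvgM; [exact: (continuous_subspaceT csig) | exact: cw'].
  exact: (cvgM (cd' t) (cd' t)).
rewrite in_itv /= => /andP[sc cf] E.
have cI : s < c < e by rewrite sc (lt_le_trans cf).
have P'c : P' c <= 0.
  apply: mulr_le0_ge0; last exact: expR_ge0.
  have wc : w c < 0 by apply: wneg; rewrite ltW.
  have s1 : sig c <= xi by apply: sig_le; rewrite (le_trans (ltW cf)).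
  have s2 : xi / 2 <= sig c.
    by rewrite /sig lerDl mulr_ge0 ?ltW // subr_gt0.
  have Uc := U0 _ cI; have Hd := d'_le _ cI.
  (* Young: 2 d d' <= (2 C / xi) d^2 + (xi / (2 C)) d'^2 *)
  have Y : 2 * d c * d' c <= 2 * C / xi * d c ^+ 2 + xi / 2 * (d c ^+ 2 + U c).
    have Y1 : 0 <= (2 * C / xi * d c - d' c) ^+ 2 by exact: sqr_ge0.
    have Y2 : 0 <= xi / (2 * C) by rewrite divr_ge0 // ltW // mulr_gt0.
    have Y3 := mulr_ge0 Y2 Y1.
    have Y4 : xi / (2 * C) * d' c ^+ 2 <= xi / (2 * C) * (C * (d c ^+ 2 + U c)).
      exact: ler_wpM2l.
    have Y5 : xi / (2 * C) * (C * (d c ^+ 2 + U c)) = xi / 2 * (d c ^+ 2 + U c).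
      by field; rewrite gt_eqF.
    have Y6 : xi / (2 * C) * (2 * C / xi * d c - d' c) ^+ 2
        = 2 * C / xi * d c ^+ 2 - 2 * d c * d' c + xi / (2 * C) * d' c ^+ 2.
      by field; rewrite !gt_eqF.
    lra.
  have X1 : sig c * (lamd * d c ^+ 2) <= xi * (lamd * d c ^+ 2).
    by apply: ler_wpM2r => //; rewrite mulr_ge0 ?sqr_ge0 // ltW.
  (* This absorbs the xi / 2 U left by Young's inequality; it is the reason why the ramp starts at
     xi / 2. *)
  have X2 : xi / 2 * U c <= sig c * U c by exact: ler_wpM2r.
  have X3 : sig c * - w c <= xi * - w c by apply: ler_wpM2r => //; lra.
  have X4 : eta * (sig c * - w c) <= eta * (xi * - w c) by apply: ler_wpM2l => //; exact: ltW.
  have X5 : beta * (sig c * - w c) <= beta * (xi * - w c) by apply: ler_wpM2l => //; exact: ltW.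
  have Eb : beta * d c ^+ 2 = 2 * C / xi * d c ^+ 2 + xi / 2 * d c ^+ 2 + xi * lamd * d c ^+ 2.
    by rewrite /beta; ring.
  have Es : slope * w c = - (beta * (xi * - w c)) - eta * (xi * - w c).
    by rewrite /slope; ring.
  have Eg : beta * (d c ^+ 2 + sig c * w c)
      = beta * d c ^+ 2 - beta * (sig c * - w c) by ring.
  rewrite Es Eg Eb; lra.
have Ps : P s < 0.
  rewrite /P pmulr_llt0 ?expR_gt0 // ds expr0n /= add0r /sig subrr mulr0 addr0.
  by rewrite pmulr_rlt0 // divr_gt0.
have : P f < 0.
  have : P' c * (f - s) <= 0 by apply: mulr_le0_ge0 => //; rewrite subr_ge0 ltW.
  rewrite -E; lra.
by rewrite /P pmulr_llt0 // expR_gt0.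
Qed.

Lemma deviation_lt_trigger (f : R) : s <= f -> f <= e -> f <= s + dwell ->
  w f < 0 -> d f ^+ 2 + sig f * w f < 0 -> d f ^+ 2 < - xi * w f.
Proof.
move=> sf fe fd wf H; have s1 := sig_le f fd.
have : sig f * - w f <= xi * - w f by apply: ler_wpM2r => //; lra.
lra.
Qed.

(** Negativity before [f] yields d^2 < - xi w before [f] through the ramp, and that excludes w
    reaching 0 at [f] itself. *)
Lemma trigger_negative_step (f : R) : s < f -> f <= e -> f <= s + dwell ->
  (forall t, s <= t < f -> w t < 0) -> w f < 0.
Proof.
move=> sf fe fd wneg; apply: (@trigger_stays_negative d w U s f) => //.
- exact: ltW.
- by apply: continuous_subspaceW cw; apply: subset_itvl; rewrite bnd_simp.
- by move=> t /andP[st tf]; apply: dw; rewrite st (lt_le_trans tf).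
- by move=> t /andP[st tf]; apply: U0; rewrite st (lt_le_trans tf).
- move=> t /andP[st tf]; apply/ltW/deviation_lt_trigger.
  + exact: ltW.
  + by rewrite (le_trans (ltW tf)).
  + by rewrite (le_trans (ltW tf)).
  + by apply: wneg; rewrite ltW.
  + apply: deviation_below_ramp => //.
    * by rewrite (le_trans (ltW tf)).
    * by rewrite (le_trans (ltW tf)).
    * by move=> t' /andP[? t't]; apply: wneg; apply/andP; split=> //; exact: lt_trans tf.
Qed.

(** Continuation: at the infimum of the times with w >= 0 the previous step still gives w < 0, and
    continuity keeps w negative shortly after, which contradicts the infimum. This breaks the mutual
    dependence of w < 0 and d^2 < - xi w. *)
Lemma trigger_negative (f : R) : s <= f -> f <= e -> f <= s + dwell -> w f < 0.
Proof.
move=> sf fe fd; apply/negP => /negP; rewrite -leNgt => wf.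
pose S := [set t | s <= t <= f /\ 0 <= w t].
have S0 : S f by split => //; rewrite sf lexx.
have lbS : has_lbound S by exists s => t [/andP[]].
have infS : has_inf S by split => //; exists f.
have sinf : s <= inf S by apply: lb_le_inf; [exists f | move=> t [/andP[]]].
have inff : inf S <= f by exact: ge_inf.
have before t : s <= t < inf S -> w t < 0.
  move=> /andP[st ti]; rewrite ltNge; apply/negP => wt.
  have : inf S <= t by apply: ge_inf => //; split => //; rewrite st (le_trans (ltW ti)).
  by rewrite leNgt ti.
have winf : w (inf S) < 0.
  move: sinf; rewrite le_eqVlt => /predU1P[<- //|sinf].
  apply: trigger_negative_step => //.
    exact: le_trans fe.
  exact: le_trans fd.
have iI : `[s, e]%classic (inf S) by rewrite /= in_itv /= sinf (le_trans inff).
have /subspace_continuousP /(_ _ iI) cwi := cw.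
have := cwi; move/cvgrPdist_lt => /(_ (- w (inf S))); rewrite oppr_gt0 => /(_ winf).
rewrite /prop_near1 /= nbhs_simpl /= => /nbhs_ballP[r /= r0 Hr].
have [t St tr] := inf_adherent r0 infS.
have it : inf S <= t by exact: ge_inf.
have := Hr t; rewrite /ball /= ler0_norm ?subr_le0 // opprB ltrBlDl.
move=> /(_ tr); case: (St) => /andP[st tf] wt.
rewrite in_itv /= st (le_trans tf fe) => /(_ isT).
rewrite ltr_norml => /andP[H1 _].
have {}H1 : - - w (inf S) < w (inf S) - w t := H1; lra.
Qed.

Theorem no_event_before_dwell (f : R) : s < f -> f <= e -> f <= s + dwell ->
  d f ^+ 2 < - xi * w f.
Proof.
move=> sf fe fd; apply: deviation_lt_trigger => //; first exact: ltW.
  by apply: trigger_negative => //; exact: ltW.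
apply: deviation_below_ramp => // t /andP[st tf].
apply: trigger_negative => //; first by rewrite (le_trans (ltW tf)).
by rewrite (le_trans (ltW tf)).
Qed.

End dwell_time.

(** * The gains [K1] and [K2] over the parameter set *)

(** Lets the smooth gain stand for [K1] under an integral although [K1] contains a junk derivative
    at y = 1: the end point has measure zero. *)
Lemma integral_eq_off_endpoint (R : realType) (f g : R -> R) :
  (forall y, 0 <= y < 1 -> f y = g y) ->
  (@lebesgue_measure R).-integrable `[0, 1] (EFin \o g) ->
  \int[@lebesgue_measure R]_(y in `[0, 1]) f y
  = \int[@lebesgue_measure R]_(y in `[0, 1]) g y.
Proof.
move=> fg gi.
have gi' : (@lebesgue_measure R).-integrable `[0, 1[ (EFin \o g).
  by apply: integrableS gi => //; exact: subset_itv_co_cc.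
have fi' : (@lebesgue_measure R).-integrable `[0, 1[ (EFin \o f).
  apply: eq_integrable gi' => // y; rewrite inE /= in_itv /= => yI.
  by rewrite fg.
rewrite -(Rintegral_itv_bndo_bndc gi') -(Rintegral_itv_bndo_bndc fi').
by apply: eq_Rintegral => y; rewrite inE /= in_itv /= => /fg.
Qed.

Lemma PsiE (R : realType) (eps : R) (th : R * R) (x y : R) :
  0 < eps -> 0 <= th.1 -> y ^+ 2 <= x ^+ 2 ->
  Psi eps th x y
  = - (th.1 / eps) * x * besselD 0 (th.1 / eps * (x ^+ 2 - y ^+ 2)).
Proof.
move=> eps0 l0 yx; rewrite /Psi; congr (_ * _).
rewrite -besselI1_div_sqrt; last by rewrite mulr_ge0 ?subr_ge0 // divr_ge0 // ltW.
by congr (besselI1_div (Num.sqrt _)); rewrite mulrAC.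
Qed.

Lemma Psix1E (R : realType) (eps : R) (th : R * R) (y : R) :
  0 < eps -> 0 <= th.1 -> 0 <= y < 1 ->
  Psix1 eps th y
  = - (th.1 / eps) * (besselD 0 (th.1 / eps * (1 - y ^+ 2))
      + 2 * (th.1 / eps) * besselD 1 (th.1 / eps * (1 - y ^+ 2))).
Proof.
move=> eps0 l0 /andP[y0 y1]; set c := th.1 / eps.
rewrite /Psix1 derive1E.
have D1 : is_derive (1 : R) 1 (fun x => c * (x ^+ 2 - y ^+ 2)) (2 * c).
  by auto_is_derive; ring.
have D2 := is_derive_besselD 0 (c * (1 ^+ 2 - y ^+ 2)).
have D3 := @is_derive1_comp R (besselD 0) (fun x => c * (x ^+ 2 - y ^+ 2)) 1 _ _ D2 D1.
have D : is_derive (1 : R) 1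
    (fun x => - c * x * besselD 0 (c * (x ^+ 2 - y ^+ 2)))
    (- c * (besselD 0 (c * (1 - y ^+ 2)) + 2 * c * besselD 1 (c * (1 - y ^+ 2)))).
  by auto_is_derive; rewrite expr1n; ring.
rewrite -(@derive_val _ _ _ _ _ _ _ D); apply: near_eq_derive.
(* The closed formula for [Psi] holds for x > y only, so y < 1 is needed to have it on a
   neighbourhood of x = 1. *)
have xI : (1 : R) \in `]y, 2[ by rewrite in_itv /= y1 ltr1n.
have := near_in_itvoo xI; apply: filterS => x; rewrite in_itv /= => /andP[yx _].
by rewrite PsiE //; nra.
Qed.

Section gains_on_Theta.
Context {R : realType}.
Variables (eps b q lamlo lamhi alo ahi kappa : R) (h hx : R * R -> R -> R -> R).
Hypotheses (eps0 : 0 < eps) (lamlo0 : 0 < lamlo) (alo0 : 0 < alo).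
Hypothesis abk : ahi < b * kappa.
Hypothesis Kh : forall th, Theta lamlo lamhi alo ahi th ->
  kernel_solution eps b kappa th (h th) (hx th).

Let A := Theta lamlo lamhi alo ahi.
Let k := b * kappa / eps.
Let c (th : R * R) := th.1 / eps.
Let mu (th : R * R) := Num.sqrt (th.2 / eps).
Let r := rgain eps q.
Let m0 := Num.sqrt (alo / eps).

Let m0_gt0 : 0 < m0. Proof. by rewrite sqrtr_gt0 divr_gt0. Qed.

Let th1_ge0 (th : R * R) : lamlo <= th.1 -> 0 <= th.1.
Proof. exact: le_trans (ltW lamlo0). Qed.

Let mu_ge th : A th -> m0 <= mu th.
Proof.
move=> [_ /andP[a0 _]]; apply: ler_wsqrtr.
by rewrite ler_wpM2r // invr_ge0 ltW.
Qed.

Let bc : bounded_on A c.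
Proof.
exists (lamhi / eps) => th [/andP[l0 l1] _].
have e0 : 0 <= eps^-1 by rewrite invr_ge0 ltW.
by rewrite ger0_norm; [exact: ler_wpM2r | apply: mulr_ge0 => //; exact: th1_ge0].
Qed.

Let bmu : bounded_on A mu.
Proof.
exists (Num.sqrt (ahi / eps)) => th [_ /andP[_ a1]].
by rewrite ger0_norm ?sqrtr_ge0 //; apply: ler_wsqrtr; rewrite ler_wpM2r // invr_ge0 ltW.
Qed.

Let br : bounded_on A r.
Proof.
exists (`|q| + lamhi / (2 * eps)) => th [/andP[l0 l1] _].
rewrite /r /rgain; apply: le_trans (ler_normB _ _) _; rewrite lerD2l.
have e2 : 0 <= (2 * eps)^-1 by rewrite invr_ge0 mulr_ge0 // ltW.
by rewrite ger0_norm; [exact: ler_wpM2r | apply: mulr_ge0 => //; exact: th1_ge0].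
Qed.

Let kerphiE th y : A th -> 0 <= y <= 1 ->
  hx th 1 y + r th * h th 1 y = kerphi k mu r th y.
Proof.
move=> Ath yI; have [_ /andP[a0 a1]] := Ath.
have [||-> -> //] := @kernel_explicit R eps b kappa th (h th) (hx th) eps0 _ _ (Kh _ Ath) y yI.
- exact: lt_le_trans a0.
- exact: le_lt_trans abk.
Qed.

Lemma K1_gain th y : A th -> 0 <= y < 1 ->
  K1 eps q h hx th y = gain k c mu r th y.
Proof.
move=> Ath yI; have [y0 y1] := andP yI; have [/andP[l0 _] _] := Ath.
have yI' : 0 <= y <= 1 by rewrite y0 ltW.
have l0' := th1_ge0 _ l0.
rewrite /K1 /gain Psix1E // PsiE //; last by rewrite expr1n; nra.
rewrite -/(c th) -/(r th) -(kerphiE _ _ Ath yI').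
rewrite (@volterraE R _ A k m0 c mu r m0_gt0 mu_ge 0 th y Ath yI').
have -> : \int[@lebesgue_measure R]_(z in `[y, 1])
      ((hx th 1 z + r th * h th 1 z) * Psi eps th z y)
    = - c th * \int[@lebesgue_measure R]_(z in `[y, 1]) volterra_integrand k c mu r 0 th z y.
  rewrite -RintegralZl //; last exact: (@integrable_volterra R _ A k m0).
  apply: eq_Rintegral => z; rewrite inE /= in_itv /= => /andP[yz z1].
  have zI : 0 <= z <= 1 by rewrite z1 (le_trans y0).
  have yz2 : y ^+ 2 <= z ^+ 2 by nra.
  rewrite (kerphiE _ _ Ath zI) PsiE //.
  by rewrite /volterra_integrand -/(c th); ring.
rewrite expr1n; ring.
Qed.

Lemma derive1_gamma th : derive1 (gamma eps b kappa th) 1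
  = kappa * Num.sqrt ((b * kappa - th.2) / eps)
    * sin (Num.sqrt ((b * kappa - th.2) / eps)).
Proof.
rewrite derive1E /gamma; set w := Num.sqrt _.
have D : is_derive (1 : R) 1 (fun x => - kappa * cos (w * x)) (kappa * w * sin w).
  by auto_is_derive; rewrite mulr1; ring.
exact: derive_val.
Qed.

Lemma K2_bounded : bounded_on A (K2 eps b q kappa h hx).
Proof.
have [M M0 HM] := @kerF_bounded R _ A k m0 mu m0_gt0 mu_ge bmu.
(* [W] bounds the frequency of [gamma] uniformly, since a is positive. *)
have [N HN] := br; pose W := Num.sqrt (b * kappa / eps).
exists (`|kappa| * W + `|N| * `|kappa| + (M + `|N| * M) * `|kappa|) => th Ath.
have [_ /andP[a0 a1]] := Ath.
set w := Num.sqrt ((b * kappa - th.2) / eps).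
have wW : `|w| <= W.
  rewrite ger0_norm ?sqrtr_ge0 //; apply: ler_wsqrtr.
  by apply: ler_wpM2r; [rewrite invr_ge0 ltW | rewrite gerBl (le_trans (ltW alo0))].
have gm x : `|gamma eps b kappa th x| <= `|kappa|.
  rewrite /gamma normrM normrN -[leRHS]mulr1; apply: ler_wpM2l => //.
  by rewrite ler_norml cos_geN1 cos_le1.
have rN : `|r th| <= `|N| by rewrite (le_trans (HN _ Ath)) // ler_norm.
rewrite /K2 derive1_gamma -/w -/(r th).
apply: le_trans (ler_normB _ _) _; apply: lerD.
  apply: le_trans (ler_normD _ _) _; apply: lerD; last by rewrite normrM ler_pM.
  rewrite normrM -[leRHS]mulr1; apply: ler_pM => //.
    by rewrite normrM ler_wpM2l.
  by rewrite ler_norml sin_geN1 sin_le1.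
have -> : \int[@lebesgue_measure R]_(y in `[0, 1])
     ((hx th 1 y + r th * h th 1 y) * gamma eps b kappa th y)
   = \int[@lebesgue_measure R]_(y in `[0, 1]) (kerphi k mu r th y * gamma eps b kappa th y).
  by apply: eq_Rintegral => y; rewrite inE /= in_itv /= => yI; rewrite kerphiE.
rewrite -[leRHS]mulr1 -[X in _ * X](subr0 1); apply: normr_integral_le => //.
- apply: continuous_compact_integrable; first exact: segment_compact.
  apply: continuous_subspaceT => y; apply: cvgM.
    exact: (@continuous_kerphi R _ A k m0 mu r m0_gt0 mu_ge).
  apply: cvgM; first exact: cvg_cst.
  by apply: is_derive_continuous; auto_is_derive; reflexivity.
- move=> y /andP[y0 y1]; rewrite normrM; apply: ler_pM => //.
  have [|F1 F2] := HM th (1 - y) Ath; first by rewrite ler_norml; apply/andP; split; lra.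
  apply: le_trans (ler_normD _ _) _; apply: lerD => //.
  by rewrite normrM; exact: ler_pM.
Qed.

(** Two derivatives of the gain are what the two integrations by parts consume; a single constant
    serves all parameters and all three orders. *)
Lemma gain_data : exists2 M, 0 < M & forall th, A th ->
  exists K K' K'' : R -> R,
  [/\ forall y, 0 <= y < 1 -> K1 eps q h hx th y = K y,
      forall y : R, 0 <= y <= 1 -> is_derive y 1 K (K' y),
      forall y : R, 0 <= y <= 1 -> is_derive y 1 K' (K'' y),
      {within `[0, 1], continuous K''} &
      forall y, 0 <= y <= 1 -> [/\ `|K y| <= M, `|K' y| <= M & `|K'' y| <= M]].
Proof.
have [[M0 H0] [G' dG [[M1 H1] [G'' dG' [[M2 H2] cG'']]]]] :=
  @usmooth_gain R _ A k m0 c mu r m0_gt0 mu_ge bc bmu br 2.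
exists (1 + `|M0| + `|M1| + `|M2|).
  by rewrite !ltr_wpDr.
move=> th Ath; exists (gain k c mu r th), (G' th), (G'' th); split.
- by move=> y; exact: K1_gain.
- by move=> y; exact: dG.
- by move=> y; exact: dG'.
- exact: cG''.
- have N0 := ler_norm M0; have N1 := ler_norm M1; have N2 := ler_norm M2.
  have P0 := normr_ge0 M0; have P1 := normr_ge0 M1; have P2 := normr_ge0 M2.
  move=> y yI; split.
  + by apply: le_trans (H0 _ _ Ath yI) _; lra.
  + by apply: le_trans (H1 _ _ Ath yI) _; lra.
  + by apply: le_trans (H2 _ _ Ath yI) _; lra.
Qed.

End gains_on_Theta.

(** * The growth rate of the deviation *)

Lemma normr_le_of_sqr (R : realFieldType) (x S : R) :
  0 <= S -> x ^+ 2 <= S ^+ 2 -> `|x| <= S.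
Proof. by move=> S0; rewrite -[x ^+ 2]real_normK ?num_real // ler_pXn2r ?nnegrE. Qed.

Section deviation_dynamics.
Context {R : realType}.
Variables (eps b q lam a : R) (s e Ud : R) (v : R -> R -> R) (z : R -> R).
Hypothesis eps_gt0 : 0 < eps.
Let eps_ge0 := ltW eps_gt0.
Hypothesis plant : plant_solution eps b q (lam, a) Ud s e v z.
Variables (K1 K K' K'' : R -> R) (k2 M M2 L amax : R).
Hypothesis M_gt0 : 0 < M.
Hypothesis K1E : forall y, 0 <= y < 1 -> K1 y = K y.
Hypothesis dK : forall y : R, 0 <= y <= 1 -> is_derive y 1 K (K' y).
Hypothesis dK' : forall y : R, 0 <= y <= 1 -> is_derive y 1 K' (K'' y).
Hypothesis cK'' : {within `[0, 1], continuous K''}.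
Hypothesis bK : forall y, 0 <= y <= 1 -> [/\ `|K y| <= M, `|K' y| <= M & `|K'' y| <= M].
Hypotheses (k2M : `|k2| <= M2) (lamL : `|lam| <= L) (aM : `|a| <= amax).
Hypothesis UdE :
  Ud = \int[@lebesgue_measure R]_(y in `[0, 1]) (K1 y * v y s) + k2 * z s.

Let d (t : R) := \int[@lebesgue_measure R]_(y in `[0, 1]) (K1 y * (v y t - v y s))
  + k2 * (z t - z s).
Let moment (t : R) := \int[@lebesgue_measure R]_(y in `[0, 1]) (K y * v y t).
Let U t := v 1 t ^+ 2 + v 0 t ^+ 2 + L2norm_sq (v ^~ t) + z t ^+ 2.

Let cK : {within `[0, 1], continuous K}.
Proof.
apply: derivable_within_continuous => y; rewrite in_itv /= => yI.
exact: is_derive_derivable (dK _ yI).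
Qed.

Let iK t : s <= t <= e ->
  (@lebesgue_measure R).-integrable `[0, 1] (EFin \o (fun y => K y * v y t)).
Proof.
by move=> tI; apply: L2_01_integrableM => //; exact: (plant_L2 _ _ _ _ _ _ _ _ _ _ plant).
Qed.

(** The sampled part of d is exactly the input held on the interval. Read one way, this isolates the
    dependence on t; read the other way, it recovers the input from current quantities. *)
Lemma deviation_decomp t : s <= t <= e -> d t = moment t + k2 * z t - Ud.
Proof.
move=> tI; have sI : s <= s <= e by case/andP: tI => ? ?; rewrite lexx; lra.
have E t' : s <= t' <= e ->
    \int[@lebesgue_measure R]_(y in `[0, 1]) (K1 y * v y t') = moment t'.
  move=> t'I; apply: integral_eq_off_endpoint; last exact: iK.
  by move=> y yI; rewrite K1E.
rewrite UdE E // /d.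
have -> : \int[@lebesgue_measure R]_(y in `[0, 1]) (K1 y * (v y t - v y s))
    = moment t - moment s.
  rewrite /moment -RintegralB //; try exact: iK.
  have j := integrableB _ (iK _ tI) (iK _ sI).
  apply: integral_eq_off_endpoint; last exact: j.
  by move=> y yI; rewrite K1E // mulrBr.
ring.
Qed.

Lemma deviation_within_continuous : {within `[s, e], continuous d}.
Proof.
have bK0 y : 0 <= y <= 1 -> `|K y| <= M by move=> /bK[].
have cm := moment_within_continuous _ _ _ _ _ _ _ _ _ _ plant K K' M M_gt0 dK bK0.
have cz := ode_within_continuous _ _ _ _ _ _ _ _ _ _ plant.
apply/subspace_continuousP => t tI; move: (tI); rewrite /= in_itv /= => tI'.
move/subspace_continuousP : cm => /(_ t tI) cm.
move/subspace_continuousP : cz => /(_ t tI) cz.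
have H : (fun t => moment t + k2 * z t - Ud) @ within `[s, e] (nbhs t)
    --> moment t + k2 * z t - Ud.
  apply: cvgB; last exact: cvg_cst.
  by apply: cvgD; [exact: cm | apply: cvgM; [exact: cvg_cst | exact: cz]].
rewrite [X in _ --> X]deviation_decomp //; apply: cvg_trans H; apply: near_eq_cvg.
near=> t'; rewrite [RHS]deviation_decomp //.
have : t' \in `[s, e] by near: t'; exact: withinT.
by rewrite in_itv.
Unshelve. all: by end_near. Qed.

Definition deviation_rate (t : R) :=
  moment_rate eps q lam Ud K K' K'' (v 1 t) (v 0 t) (v ^~ t)
  + k2 * (a * z t + b * v 0 t).

Lemma is_derive_deviation (t : R) : s < t < e -> is_derive t 1 d (deviation_rate t).
Proof.
move=> tI; have bK0 y : 0 <= y <= 1 -> `|K y| <= M by move=> /bK[].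
have D1 := is_derive_moment _ _ _ _ _ _ _ _ _ _ plant K K' K'' M dK dK' cK'' bK0 _ tI.
have D2 := is_derive_ode _ _ _ _ _ _ _ _ _ _ plant _ tI.
have D : is_derive t 1 (fun t => moment t + k2 * z t - Ud) (deviation_rate t).
  by rewrite /moment; auto_is_derive; rewrite /deviation_rate subr0.
apply: near_eq_is_derive D; have tI' : t \in `]s, e[ by rewrite in_itv.
have := near_in_itvoo tI'; apply: filterS => t'; rewrite in_itv /= => /andP[t1 t2].
by rewrite deviation_decomp // !ltW.
Qed.

(** The terms of [deviation_rate] measured in units of sqrt(d^2 + U): M + M2 + 1 bounds the input,
    |q| the boundary feedback, eps M + L M the weight of the integral, and amax + |b| the right-hand
    side of the ODE. *)
Definition rate_const : R :=
  eps * (M * (M + M2 + 1 + `|q|) + M + M) + (eps * M + L * M) + M2 * (amax + `|b|).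

Lemma deviation_rate_le (t : R) : s < t < e ->
  deviation_rate t ^+ 2 <= rate_const ^+ 2 * (d t ^+ 2 + U t).
Proof.
move=> tI; have tI' : s <= t <= e by case/andP: tI => ? ?; rewrite !ltW.
have w2 : L2_01 (v ^~ t) by exact: (plant_L2 _ _ _ _ _ _ _ _ _ _ plant).
have N0 : 0 <= L2norm_sq (v ^~ t) by apply: Rintegral_ge0 => x _; exact: sqr_ge0.
have E0 : 0 <= d t ^+ 2 + U t.
  by rewrite addr_ge0 ?sqr_ge0 // /U !addr_ge0 ?sqr_ge0.
pose S := Num.sqrt (d t ^+ 2 + U t).
have S0 : 0 <= S by exact: sqrtr_ge0.
have S2 : S ^+ 2 = d t ^+ 2 + U t by rewrite sqr_sqrtr.
have p1 := sqr_ge0 (v 1 t); have p2 := sqr_ge0 (v 0 t).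
have p3 := sqr_ge0 (z t); have p4 := sqr_ge0 (d t).
have dS : `|d t| <= S by apply: normr_le_of_sqr => //; rewrite S2 /U; lra.
have v1S : `|v 1 t| <= S by apply: normr_le_of_sqr => //; rewrite S2 /U; lra.
have v0S : `|v 0 t| <= S by apply: normr_le_of_sqr => //; rewrite S2 /U; lra.
have zS : `|z t| <= S by apply: normr_le_of_sqr => //; rewrite S2 /U; lra.
have NS : L2norm_sq (v ^~ t) <= S ^+ 2 by rewrite S2 /U; lra.
have mS : `|moment t| <= M * S.
  apply: normr_le_of_sqr; first by rewrite mulr_ge0 // ltW.
  have bK0 y : 0 <= y <= 1 -> `|K y| <= M by move=> /bK[].
  apply: le_trans (sqr_integralM_le _ K _ M M_gt0 cK bK0 w2) _.
  by rewrite exprMn ler_wpM2l // sqr_ge0.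
have M0 := ltW M_gt0.
have M20 : 0 <= M2 by exact: le_trans k2M.
have L0 : 0 <= L by exact: le_trans lamL.
have amax0 : 0 <= amax by exact: le_trans aM.
(* The summand 1 is the share of d in the recovered input. *)
have UdS : `|Ud| <= (M + M2 + 1) * S.
  have -> : Ud = moment t + k2 * z t - d t by rewrite deviation_decomp //; ring.
  apply: le_trans (ler_normB _ _) _; rewrite !mulrDl mul1r; apply: lerD => //.
  apply: le_trans (ler_normD _ _) _; apply: lerD => //.
  by rewrite normrM; exact: ler_pM.
have I01 : is_true (0 <= (1 : R) <= 1) by rewrite ler01 /=.
have I00 : is_true (0 <= (0 : R) <= 1) by rewrite lexx /=.
have [K11 K'1 _] := bK _ I01; have [_ K'0 _] := bK _ I00.
have iS : `|\int[@lebesgue_measure R]_(y in `[0, 1]) ((eps * K'' y + lam * K y) * v y t)|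
    <= (eps * M + L * M) * S.
  have cL : {within `[0, 1], continuous (fun y => eps * K'' y + lam * K y)}.
    by move=> y; apply: cvgD; apply: cvgM; solve [exact: cvg_cst | exact: cK'' | exact: cK].
  have bL y : 0 <= y <= 1 -> `|eps * K'' y + lam * K y| <= eps * M + L * M.
    move=> yI; have [B0 _ B2] := bK _ yI.
    apply: le_trans (ler_normD _ _) _; apply: lerD; rewrite normrM.
      by rewrite (ger0_norm eps_ge0); exact: ler_wpM2l.
    exact: ler_pM.
  have B0 : 0 < eps * M + L * M by rewrite ltr_pwDl ?mulr_gt0 ?mulr_ge0.
  apply: normr_le_of_sqr; first by rewrite mulr_ge0 // ltW.
  apply: le_trans (sqr_integralM_le _ _ _ _ B0 cL bL w2) _.
  by rewrite exprMn ler_wpM2l // sqr_ge0.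
rewrite -S2 -exprMn -[X in X <= _]real_normK ?num_real //.
apply: lerXn2r; rewrite ?nnegrE //.
  rewrite /rate_const; do ?[apply: mulr_ge0 => // | apply: addr_ge0 => //].
apply: (@le_trans _ _ (eps * (M * ((M + M2 + 1) * S + `|q| * S) + M * S + M * S)
   + (eps * M + L * M) * S + M2 * (amax * S + `|b| * S))); last first.
  by rewrite le_eqVlt; apply/orP; left; apply/eqP; rewrite /rate_const; ring.
rewrite /deviation_rate /moment_rate.
apply: le_trans (ler_normD _ _) _; apply: lerD.
  apply: le_trans (ler_normD _ _) _; apply: lerD => //.
  rewrite normrM (ger0_norm eps_ge0); apply: ler_wpM2l => //.
  apply: le_trans (ler_normD _ _) _; apply: lerD; last by rewrite normrM; exact: ler_pM.
  apply: le_trans (ler_normB _ _) _; apply: lerD; last by rewrite normrM; exact: ler_pM.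
  rewrite normrM; apply: ler_pM => //.
  apply: le_trans (ler_normB _ _) _; apply: lerD => //.
  by rewrite normrM; exact: ler_wpM2l.
rewrite normrM; apply: ler_pM => //.
apply: le_trans (ler_normD _ _) _; apply: lerD; rewrite normrM.
  exact: ler_pM.
exact: ler_wpM2l.
Qed.

End deviation_dynamics.

(** * The dwell-time along closed-loop trajectories *)

Theorem lemma2 (R : realType)
    (eps b q lamlo lamhi alo ahi kappa : R)
    (h hx : R * R -> R -> R -> R)
    (xi eta lamd T : R) (N : nat) :
  0 < eps -> b != 0 ->
  0 < lamlo -> 0 < lamhi -> 0 < alo -> 0 < ahi ->
  1 / 4 + lamhi / (2 * eps) < q ->
  ahi < b * kappa ->
  (forall th, Theta lamlo lamhi alo ahi th ->
     kernel_solution eps b kappa th (h th) (hx th)) ->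
  0 < xi -> 0 < eta -> 0 < lamd -> 0 < T -> (1 <= N)%N ->
  exists k1 k2 k3 k4 : R,
    [/\ 0 < k1, 0 < k2, 0 < k3 & 0 < k4] /\
    exists tau : R, 0 < tau /\
      forall (th : R * R) (t : nat -> R) (thh : nat -> R * R)
             (u : R -> R -> R) (zeta m : R -> R),
        Theta lamlo lamhi alo ahi th ->
        closed_loop eps b q lamlo lamhi alo ahi kappa h hx
          xi eta lamd T N k1 k2 k3 k4 th t thh u zeta m ->
        forall i : nat, tau <= t i.+1 - t i.
Proof.
move=> eps0 b0 lamlo0 lamhi0 alo0 ahi0 _ abk Kh xi0 eta0 lamd0 T0 _.
have [M M0 HM] := gain_data eps b q lamlo lamhi alo ahi kappa h hx eps0 lamlo0 alo0 abk Kh.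
have [M2 HM2] := K2_bounded eps b q lamlo lamhi alo ahi kappa h hx eps0 lamlo0 alo0 abk Kh.
pose C1 := rate_const eps b q M M2 lamhi ahi.
(* Adding 1 makes the constant positive whatever [C1] is. *)
pose C := C1 ^+ 2 + 1.
have C0 : 0 < C by rewrite ltr_wpDl // sqr_ge0.
exists 1, 1, 1, 1; split; first by [].
pose tau := dwell xi eta lamd C.
have tau0 : 0 < tau by exact: dwell_gt0.
(* An update is forced after time [T], which may be shorter than [tau]. *)
exists (Num.min tau T); split; first by rewrite lt_min tau0.
move=> th t thh u zeta m Ath [t0 m0 Ath0 step upd].
have Athh i : Theta lamlo lamhi alo ahi (thh i).
  by case: i => [//|i]; have [[]] := upd i.
have [/andP[l1 l2] /andP[a1 a2]] := Ath.
(* The dwell argument starts from m(t_i) < 0, so negativity has to be passed on to the next event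
   together with the bound. *)
have key i : m (t i) < 0 -> Num.min tau T <= t i.+1 - t i /\ m (t i.+1) < 0.
  move=> mi; have [e [v [z [w [[te t1e] tr plant [cw dw] tE]]]]] := step i.
  set d := deviation _ _ _ _ _ _ _ _ _ _ in dw tE.
  set Ud := control _ _ _ _ _ _ _ _ _ in plant.
  set S := [set s | _] in tE.
  (* Only the weak inequality is available before the dwell estimate; it suffices to identify the
     trajectory with the evolution (v, z, w) at t_i. *)
  have tt1 : t i <= t i.+1.
    rewrite -lee_fin tE le_min lee_fin lerDl (ltW T0) andbT.
    by apply: le_ereal_inf_tmp => _ [s [/andP[ts _] _] <-]; rewrite lee_fin ltW.
  have [uti zti mti] := tr (t i) ltac:(by rewrite lexx).
  have [K [K' [K'' [KE dK dK' cK'' bK]]]] := HM _ (Athh i).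
  have UdE : Ud = \int[@lebesgue_measure R]_(y in `[0, 1])
      (K1 eps q h hx (thh i) y * v y (t i)) + K2 eps b q kappa h hx (thh i) * z (t i).
    rewrite /Ud /control zti; congr (_ + _); apply: eq_Rintegral => y.
    by rewrite inE /= in_itv /= => /uti ->.
  have plant' : plant_solution eps b q (th.1, th.2) Ud (t i) e v z.
    by case: (th) plant.
  have lamL : `|th.1| <= lamhi by rewrite ger0_norm; [|exact: le_trans (ltW lamlo0) l1].
  have aM : `|th.2| <= ahi by rewrite ger0_norm; [|exact: le_trans (ltW alo0) a1].
  pose U s := v 1 s ^+ 2 + v 0 s ^+ 2 + L2norm_sq (v ^~ s) + z s ^+ 2.
  have U0 s : 0 <= U s.
    rewrite /U !addr_ge0 ?sqr_ge0 //.
    by apply: Rintegral_ge0 => x _; exact: sqr_ge0.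
  have dw' (s : R) : t i < s < e -> is_derive s 1 w (- eta * w s + lamd * d s ^+ 2 - U s).
    by move=> sI; apply: (is_derive_eq (dw s sI)); rewrite /U; ring.
  have wi : w (t i) < 0 by rewrite -mti.
  have ds : d (t i) = 0.
    rewrite /d /deviation subrr mulr0 addr0.
    under eq_Rintegral => y _ do rewrite subrr mulr0.
    by rewrite Rintegral_cst // mul0r.
  have noev s : t i < s -> s <= e -> s <= t i + tau -> d s ^+ 2 < - xi * w s.
    apply: (@no_event_before_dwell R xi eta lamd C xi0 eta0 lamd0 C0 d
      (deviation_rate eps b q th.1 th.2 Ud v z K K' K'' (K2 eps b q kappa h hx (thh i)))
      w U (t i) e) => //.
    - exact: (deviation_within_continuous _ _ _ _ _ _ _ _ _ _ plant' _ _ _ _ _ M M0 KE dK bK UdE).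
    - move=> s' s'I.
      exact: (is_derive_deviation _ _ _ _ _ _ _ _ _ _ plant' _ _ _ _ _ M KE dK dK' cK'' bK UdE).
    - move=> s' s'I.
      have := deviation_rate_le _ _ _ _ _ _ _ _ _ _ eps0 plant' _ _ _ _ _ M M2 lamhi ahi M0
        KE dK cK'' bK (HM2 _ (Athh i)) lamL aM UdE s' s'I.
      move=> /le_trans; apply.
      apply: ler_wpM2r; last by rewrite /C /C1 lerDl.
      by rewrite addr_ge0 ?sqr_ge0 // U0.
  (* If the evolution ends before t_i + tau, no admissible event time exists, the infimum is +oo and
     the next event comes after exactly [T]. *)
  have tau_le : Num.min tau T <= t i.+1 - t i.
    rewrite lerBrDl -lee_fin tE le_min lee_fin lerD2l ge_min lexx orbT andbT.
    apply: le_ereal_inf_tmp => _ [s [/andP[ts se] ev] <-]; rewrite lee_fin.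
    apply: (@le_trans _ _ (t i + tau)); first by rewrite lerD2l ge_min lexx.
    rewrite leNgt; apply/negP => st.
    by have := noev s ts se (ltW st); rewrite ltNge ev.
  split => //.
  have lt1 : t i < t i.+1.
    by rewrite -subr_gt0; apply: lt_le_trans tau_le; rewrite lt_min tau0.
  have [_ _ ->] := tr (t i.+1) ltac:(by rewrite lexx tt1).
  (* Beyond the dwell time the rule itself keeps d^2 <= - xi w up to the next event: an earlier
     violation would belong to the set whose infimum is taken. *)
  apply: (@trigger_stays_negative R xi eta lamd lamd0 d w U (t i) (t i.+1)) => //.
  - by apply: continuous_subspaceW cw; apply: subset_itvl; rewrite bnd_simp.
  - by move=> s /andP[s1 s2]; apply: dw'; rewrite s1 (lt_le_trans s2).
  - move=> s /andP[s1 s2]; rewrite leNgt; apply/negP => ev.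
    have : ((t i.+1)%:E <= s%:E)%E.
      rewrite tE ge_min; apply/orP; left; apply: ereal_inf_lbound.
      exists s => //; split; last exact: ltW.
      by rewrite s1 (le_trans (ltW s2)).
    by rewrite lee_fin leNgt s2.
move=> i; suff mneg j : m (t j) < 0 by have [] := key i (mneg i).
by elim: j => [|j IHj]; [rewrite t0 | have [] := key j IHj].
Qed.
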